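(* Let $b\ge 2$ be an integer and $D\subset\{0,\dots,b-1\}$, and suppose that either $b\geq 5$ and $\#D=b-1$, or $b=4$ and $D=\{1,2,3\}$ or $D=\{0,1,2\}$. Let $K=K_{b,D}$ and let $\nu$ be the natural measure on $K$. Then there exists an effectively-computable $\varrho>0$ such that \[ \nu(W_K(2-\varrho))=0. \]
   Context: For an integer $b\ge 2$ and $D\subset\{0,\dots,b-1\}$ with $|D|\ge 2$, $K_{b,D}$ is the set of real numbers in $[0,1]$ having at least one base-$b$ expansion with all digits in $D$. The natural measure $\nu_{b,D}$ on $K_{b,D}$ is the distribution of the random sum $\sum_{i\ge1}D_i b^{-i}$, where $D_1,D_2,\dots$ are i.i.d. random variables uniformly distributed on $D$. For a closed set $K\subset\mathbb R$ and $\alpha\ge1$, $W_K(\alpha)$ is the set of $x\in\mathbb R$ for which the inequality $|x-p/q|<q^{-\alpha}$ with $p/q\in K$ has infinitely many solutions $(p,q)\in\mathbb Z\times\mathbb N$. *)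

(* Defs.v *)
From HB Require Import structures.
From mathcomp Require Export all_boot all_order all_algebra.
From mathcomp Require Export all_classical all_reals all_analysis.
Set Implicit Arguments.
Unset Strict Implicit.
Unset Printing Implicit Defensive.
Import Order.TTheory GRing.Theory Num.Theory.
Import numFieldNormedType.Exports.
Local Open Scope classical_set_scope.
Local Open Scope ring_scope.

(* Total recursive functions nat^k -> nat: the least class containing the
   zero, successor and projection functions and closed under composition,
   primitive recursion and minimization of regular functions.  The recursion
   (resp. minimization) variable is the first coordinate. *)
Inductive recursive : forall k : nat, (k.-tuple nat -> nat) -> Prop :=
| recursive_zero k : recursive (fun _ : k.-tuple nat => 0%N)
| recursive_succ : recursive (fun v : 1.-tuple nat => (thead v).+1)
| recursive_proj k (i : 'I_k) : recursive (fun v : k.-tuple nat => tnth v i)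
| recursive_comp k m (g : m.-tuple nat -> nat)
    (h : 'I_m -> k.-tuple nat -> nat) :
    recursive g -> (forall i, recursive (h i)) ->
    recursive (fun v => g [tuple h i v | i < m])
| recursive_primrec k (g : k.-tuple nat -> nat)
    (h : k.+2.-tuple nat -> nat) (f : k.+1.-tuple nat -> nat) :
    recursive g -> recursive h ->
    (forall v : k.-tuple nat, f [tuple of 0%N :: v] = g v) ->
    (forall n (v : k.-tuple nat), f [tuple of n.+1 :: v] =
      h [tuple of n :: f [tuple of n :: v] :: v]) ->
    recursive f
| recursive_mu k (g : k.+1.-tuple nat -> nat) (f : k.-tuple nat -> nat) :
    recursive g ->
    (forall v : k.-tuple nat, g [tuple of f v :: v] = 0%N) ->
    (forall (v : k.-tuple nat) n, (n < f v)%N -> g [tuple of n :: v] <> 0%N) ->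
    recursive f
| recursive_ext k (f g : k.-tuple nat -> nat) :
    recursive f -> f =1 g -> recursive g.

Definition digits_code (b : nat) (D : {set 'I_b}) : nat :=
  (\sum_(a in D) 2 ^ a)%N.

(* rho b D is a computable nonnegative real, uniformly in the pairs (b, D)
   satisfying dom: one algorithm, given b, D and n, outputs a dyadic
   approximation of rho b D with denominator 2^n and error at most 2^-n. *)
Definition effectively_computable (R : realType)
    (dom : forall b : nat, {set 'I_b} -> Prop)
    (rho : forall b : nat, {set 'I_b} -> R) : Prop :=
  exists f : 3.-tuple nat -> nat, recursive f /\
    forall (b : nat) (D : {set 'I_b}), dom b D -> forall n : nat,
      `| rho b D - (f [tuple b; digits_code D; n])%:R / 2 ^+ n | <= 2 ^- n.

(* Digits are indexed from 0: d i is the digit of weight b^-(i+1). *)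
Definition missing_digit_set (R : realType) (b : nat) (D : {set 'I_b}) : set R :=
  [set x : R | 0 <= x <= 1 /\
    exists d : nat -> 'I_b, (forall i, d i \in D) /\
      series (fun i => (d i)%:R / b%:R ^+ i.+1 : R) @ \oo --> x].
Arguments missing_digit_set R {b} D.

Definition mutually_independent (R : realType) (d : measure_display)
    (T : measurableType d) (P : probability T R) (X : nat -> {RV P >-> R}) :
    Prop :=
  forall (J : seq nat) (B : nat -> set R), uniq J ->
    (forall j, measurable (B j)) ->
    P (\big[setI/setT]_(j <- J) (X j @^-1` B j)) =
      (\prod_(j <- J) P (X j @^-1` B j))%E.

(* Pointwise masses suffice: they sum to 1 over D. *)
Definition uniform_on_digits (R : realType) (d : measure_display)
    (T : measurableType d) (P : probability T R) (b : nat) (D : {set 'I_b})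
    (X : {RV P >-> R}) : Prop :=
  forall a : 'I_b, a \in D -> P (X @^-1` [set a%:R]) = (#|D|%:R^-1)%:E.

(* The random series is only asked to converge to S almost surely, since the
   X i may take values outside D on a null set. *)
Definition natural_measure (R : realType) (b : nat) (D : {set 'I_b})
    (nu : probability R R) : Prop :=
  exists (d : measure_display) (T : measurableType d) (P : probability T R)
      (X : nat -> {RV P >-> R}) (S : {RV P >-> R}),
    [/\ mutually_independent X,
        forall i, uniform_on_digits D (X i),
        {ae P, forall t, series (fun i => X i t / b%:R ^+ i.+1) @ \oo --> S t}
      & forall A : set R, measurable A -> nu A = distribution P S A].

(* Pairs (p, q) need not be in lowest terms. *)
Definition well_approximable (R : realType) (K : set R) (alpha : R) : set R :=
  [set x : R | infinite_set [set pq : int * nat |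
    [/\ (0 < pq.2)%N, K (pq.1%:~R / pq.2%:R)
      & `| x - pq.1%:~R / pq.2%:R | < pq.2%:R `^ (- alpha)]]].

Definition admissible (b : nat) (D : {set 'I_b}) : Prop :=
  (2 <= b)%N /\
  (((5 <= b)%N /\ #|D| = b.-1) \/
   (b = 4%N /\ (D = [set a : 'I_b | (a : nat) \in [:: 1; 2; 3]%N]%SET \/
                D = [set a : 'I_b | (a : nat) \in [:: 0; 1; 2]%N]%SET))).

(* Main.v *)
(** Write phi(t) for the sum of exp(2 i pi d t) over the digits d in D. If p/q
lies in K and a is the integer formed by the first n digits of p/q, then
a q / b^n is within q / b^n of an integer, so a Fejer kernel bounds the number
of pairs (p, q) with q ~ N by sums of the Fourier coefficients
prod_i |phi(k / b^(i+1))|, each k being counted at most d(k) times (number of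
divisors). These coefficients have l^1 norm at most C Lam^n as soon as some
weight w on [0, 1) satisfies
sum_(i < b) |phi((x+i)/b)| w((x+i)/b) <= Lam w(x), and for the admissible digit
sets one can take Lam < 0.995 (b-1) sqrt b: for b >= 18 from Parseval and the
presence of one term of order b, for smaller b from a step function w checked
by exact integer arithmetic. Since Lam < (b-1) sqrt b, taking b^n slightly
larger than N^2 saves a power of N over the trivial bound N^(2 s), where
s = log(b-1)/log b. As intervals of length r have measure O(r^s), the
Borel-Cantelli lemma concludes. *)

From Stdlib Require Import ZArith.
Require Import Defs.
From mathcomp Require Import complex ring lra zify ssrZ.
Set Implicit Arguments.
Unset Strict Implicit.
Unset Printing Implicit Defensive.
Import Order.TTheory GRing.Theory Num.Theory.
Import numFieldNormedType.Exports.
Local Open Scope classical_set_scope.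
Local Open Scope ring_scope.
Delimit Scope Z_scope with Z.

(** The threshold (b-1) sqrt b comes from sizes: with q about N and b^n about N^2, the kernel may
    have length H about b^n / N = b^(n/2); its error term, about Lam^n / H, must stay below (b-1)^n,
    the inverse mass of a ball of radius b^-n. Cauchy-Schwarz on Parseval's identity only gives b
    sqrt(b-1), too large by sqrt(b/(b-1)): this narrow miss is why finer bounds, depending on the
    range of b, are required.

    All scales are powers of b with exponents essentially linear in a block number k. With T =
    1/rho, block k collects b^(T k) <= q < b^(T (k+1)), n is 2 (T+V) k and balls have radius
    b^-((2T-1) k). The excess 2 V k of n makes the diagonal term small (V = b^2, see [ratio1]) but
    multiplies the Fourier term by a power of b-1, which (199/200)^(2 T k) has to repay ([ratio2]);
    T = 2^(b+12) is ample. An integer T keeps the exponents integral, and a power of two makes rho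
    dyadic, so that its computability is immediate. *)

Local Notation normc := Normc.normc.

(** * Elementary bounds for sine, cosine and pi *)

Section TrigBounds.
Context {R : realType}.
Implicit Types x y t : R.

Lemma is_derive_ge0_le (f df : R -> R) x : 0 <= x ->
  (forall y, is_derive y 1 f (df y)) -> (forall y, 0 <= y -> 0 <= df y) ->
  f 0 <= f x.
Proof.
move=> x0 dfE df0.
have cf : {within `[0, x], continuous f}.
  apply: derivable_within_continuous => y _.
  by have [] := dfE y.
have [c] := @MVT_segment R f df 0 x x0 (fun y _ => dfE y) cf.
rewrite in_itv/= => /andP[c0 _] E.
by rewrite -subr_ge0 E mulr_ge0 ?df0// subr0.
Qed.

Lemma normr_sin_le x : `|sin x| <= `|x|.
Proof.
wlog x0 : x / 0 <= x.
  move=> H; have [/H//|x0] := leP 0 x.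
  by have := H (- x); rewrite sinN !normrN oppr_ge0; apply; exact: ltW.
have A : 0 - sin 0 <= x - sin x.
  by apply: (@is_derive_ge0_le (fun y => y - sin y) (fun y => 1 - cos y)).
have B : 0 + sin 0 <= x + sin x.
  by apply: (@is_derive_ge0_le (fun y => y + sin y) (fun y => 1 + cos y)).
move: A B; rewrite sin0 (ger0_norm x0) ler_norml; lra.
Qed.

(** The formula cos x = 1 - 2 sin(x/2)^2 reduces this to |sin y| <= |y|. *)
Lemma cos_ge_sqr x : 1 - x ^+ 2 / 2 <= cos x.
Proof.
have -> : x = (x / 2) *+ 2 by rewrite -mulr_natr mulfVK.
rewrite cos_mulr2n; set y := x / 2.
have /(lerXn2r 2 (normr_ge0 _) (normr_ge0 _)) := normr_sin_le y.
rewrite !real_normK ?num_real//.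
have := cos2Dsin2 y; rewrite -[y *+ 2]mulr_natr -[cos y ^+ 2 *+ 2]mulr_natr.
have -> : (y * 2) ^+ 2 / 2 = y ^+ 2 * 2 by field.
lra.
Qed.

Lemma sin_ge_cube x : 0 <= x -> x - x ^+ 3 / 6 <= sin x.
Proof.
move=> x0.
have := @is_derive_ge0_le (fun y => sin y - (y - y ^+ 3 / 6))
  (fun y => cos y - (1 - y ^+ 2 / 2)) x x0.
rewrite sin0 expr0n/= mul0r !subr0 subr_ge0; apply.
- move=> y.
  have -> : cos y - (1 - y ^+ 2 / 2) = cos y - (1 - (6^-1 * (3%:R * y ^+ 2))).
    by field.
  have -> : (fun y => sin y - (y - y ^+ 3 / 6))
     = (fun y => sin y - (y - 6^-1 *: y ^+ 3)).
    by apply/funext => z; rewrite mulrC.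
  by apply: is_derive_eq; rewrite /GRing.scale/= !mulr1; ring.
- by move=> y _; rewrite subr_ge0 cos_ge_sqr.
Qed.

(** If pi were at least 16/5, then 8/5 <= pi/2 and cos(8/5) = 1 - 2 sin(4/5)^2 would be nonnegative;
    but the cubic bound gives sin(4/5) > 0.714, whose square exceeds 1/2. *)
Lemma pi_lt_16_5 : pi < 16 / 5 :> R.
Proof.
rewrite ltNge; apply/negP => h.
have := pi_gt0 R => pi0.
have h1 : cos (8 / 5) >= 0 :> R.
  apply: cos_ge0_pihalf; apply/andP; split; lra.
have := @sin_ge_cube (4 / 5) _ => /(_ ltac:(lra)).
move: h1; have -> : 8 / 5 = (4 / 5) *+ 2 :> R by rewrite -mulr_natr; lra.
rewrite cos_mulr2n; have := cos2Dsin2 (4 / 5 : R).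
rewrite -mulr_natr; set c := cos _; set s := sin _.
nra.
Qed.
End TrigBounds.

(** * The character exp(2 i pi t) *)

Section ComplexExponential.
Context {R : realType}.
Implicit Types s t : R.

Lemma normc_ge0 (z : R[i]) : 0 <= normc z.
Proof. by case: z => a b; rewrite sqrtr_ge0. Qed.

Lemma normc_sum (I : Type) (r : seq I) (P : pred I) (F : I -> R[i]) :
  normc (\sum_(i <- r | P i) F i) <= \sum_(i <- r | P i) normc (F i).
Proof.
elim/big_rec2: _ => [|i y x _ IH]; first by rewrite Normc.normc0.
by apply: le_trans (le_normcD _ _) _; rewrite lerD2l.
Qed.

Lemma normc_prod (I : Type) (r : seq I) (P : pred I) (F : I -> R[i]) :
  normc (\prod_(i <- r | P i) F i) = \prod_(i <- r | P i) normc (F i).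
Proof. exact: (big_morph _ (@Normc.normcM R) (@Normc.normc1 R)). Qed.

Lemma sqr_normc_def (z : R[i]) :
  normc z ^+ 2 = complex.Re z ^+ 2 + complex.Im z ^+ 2.
Proof. by case: z => a b; rewrite sqr_sqrtr// addr_ge0 ?sqr_ge0. Qed.

Lemma Re_le_normc (z : R[i]) : complex.Re z <= normc z.
Proof.
apply: le_trans (ler_norm _) _.
rewrite -(@ler_pXn2r _ 2)// ?nnegrE ?normr_ge0 ?normc_ge0//.
by rewrite sqr_normc_def real_normK ?num_real// lerDl sqr_ge0.
Qed.

Definition ex t : R[i] := (cos (2 * pi * t) +i* sin (2 * pi * t))%C.

Lemma exD s t : ex (s + t) = ex s * ex t.
Proof.
rewrite /ex mulrDr cosD sinD; apply/eqP; rewrite eq_complex/=.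
by apply/andP; split; apply/eqP; ring.
Qed.

Lemma ex0 : ex 0 = 1.
Proof. by rewrite /ex mulr0 cos0 sin0. Qed.

Lemma ex1 : ex 1 = 1.
Proof. by rewrite /ex mulr1 mulr_natl cos2pi sin2pi. Qed.

Lemma ex_nat n : ex n%:R = 1.
Proof. by elim: n => [|n IH]; rewrite ?ex0// -natr1 exD IH ex1 mulr1. Qed.

Lemma exDnat t n : ex (t + n%:R) = ex t.
Proof. by rewrite exD ex_nat mulr1. Qed.

Lemma exN t : ex (- t) * ex t = 1.
Proof. by rewrite -exD addNr ex0. Qed.

Lemma ex_int (m : int) : ex m%:~R = 1.
Proof.
case: m => n; first exact: ex_nat.
by have := exN n.+1%:R; rewrite ex_nat mulr1 NegzE mulrNz.
Qed.

Lemma exX t n : ex (n%:R * t) = ex t ^+ n.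
Proof.
elim: n => [|n IH]; first by rewrite mul0r ex0.
by rewrite -natr1 mulrDl mul1r exD IH exprSr.
Qed.

Lemma ex_sum (I : Type) (r : seq I) (P : pred I) (F : I -> R) :
  ex (\sum_(i <- r | P i) F i) = \prod_(i <- r | P i) ex (F i).
Proof. exact: (big_morph _ exD ex0). Qed.

Lemma normc_ex t : normc (ex t) = 1.
Proof. by rewrite /= cos2Dsin2 sqrtr1. Qed.

Lemma Re_ex t : complex.Re (ex t) = cos (2 * pi * t).
Proof. by []. Qed.

(** Squared, this is |exp(i w) - 1|^2 = 2 - 2 cos w <= w^2. *)
Lemma ex_dist s t : normc (ex s - ex t) <= 2 * pi * `|s - t|.
Proof.
have -> : ex s - ex t = ex t * (ex (s - t) - 1).
  by rewrite mulrBr mulr1 -exD [t + _]addrC subrK.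
rewrite Normc.normcM normc_ex mul1r; set u := s - t.
rewrite -(@ler_pXn2r _ 2)// ?nnegrE ?normc_ge0 ?mulr_ge0 ?pi_ge0//.
rewrite sqr_normc_def/= subr0.
rewrite [leRHS]exprMn real_normK ?num_real// -exprMn.
have := cos2Dsin2 (2 * pi * u); have := cos_ge_sqr (2 * pi * u).
by set c := cos _; set v := sin _; set w := 2 * pi * u; nra.
Qed.

End ComplexExponential.

Lemma sum_ord_mul (V : nmodType) (F : nat -> V) m b :
  \sum_(k < m * b) F k = \sum_(i < b) \sum_(j < m) F (j * b + i)%N.
Proof.
rewrite exchange_big/=; elim: m => [|m IH]; first by rewrite !big_ord0.
by rewrite mulSnr big_split_ord/= IH big_ord_recr.
Qed.

(** * The digit sum phi, its transfer operator and Parseval's identity *)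

Section DigitTransform.
Context {R : realType} (b : nat) (D : {set 'I_b}).
Implicit Types t x : R.

Definition phi t : R[i] := \sum_(d in D) ex (d%:R * t).

Lemma phiDnat t n : phi (t + n%:R) = phi t.
Proof.
by apply: eq_bigr => d _; rewrite mulrDr -natrM exDnat.
Qed.

Section Transfer.
Variables (w : R -> R) (Lam : R).
Hypotheses (b0 : (0 < b)%N) (Lam0 : 0 <= Lam).
Hypothesis hw : forall x, 0 <= x < 1 ->
  \sum_(i < b) normc (phi ((x + i%:R) / b%:R)) * w ((x + i%:R) / b%:R)
    <= Lam * w x.

(** Induction peels off the last base-b digit i of k = j b + i: with y = (x+i)/b the argument
    (x+k)/b^(m+1) is (y+j)/b^m, and the first factor phi(y+j) is phi(y) by periodicity, so the sum
    over j is the induction hypothesis at y. *)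
Lemma transfer_iter n x : 0 <= x < 1 ->
  \sum_(k < b ^ n) (\prod_(i < n) normc (phi ((x + k%:R) / b%:R ^+ i.+1)))
     * w ((x + k%:R) / b%:R ^+ n) <= Lam ^+ n * w x.
Proof.
have bR : b%:R != 0 :> R by rewrite pnatr_eq0 -lt0n.
elim: n x => [|n IH] x x01.
  by rewrite expn0 big_ord1 big_ord0 !mul1r expr0 divr1 addr0.
pose F (k : nat) := (\prod_(i < n.+1) normc (phi ((x + k%:R) / b%:R ^+ i.+1)))
     * w ((x + k%:R) / b%:R ^+ n.+1).
rewrite expnSr (sum_ord_mul F).
apply: le_trans (_ : Lam ^+ n * (\sum_(i < b) normc (phi ((x + i%:R) / b%:R))
                              * w ((x + i%:R) / b%:R)) <= _); last first.
  by rewrite exprSr -mulrA ler_wpM2l ?exprn_ge0// hw.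
rewrite mulr_sumr; apply: ler_sum => i _.
set y := (x + i%:R) / b%:R.
have y01 : 0 <= y < 1.
  case/andP: x01 => x0 x1.
  rewrite divr_ge0 ?addr_ge0//= ltr_pdivrMr ?ltr0n// mul1r.
  have : (i.+1 <= b)%N by [].
  rewrite -(ler_nat R) -natr1; lra.
rewrite mulrCA; apply: le_trans (ler_wpM2l (normc_ge0 _) (IH y y01)).
rewrite mulr_sumr; apply: ler_sum => j _.
have E (m : nat) : (x + (j * b + i)%:R) / b%:R ^+ m.+1 = (y + j%:R) / b%:R ^+ m.
  rewrite natrD natrM exprS invfM mulrA; congr (_ / _).
  rewrite /y addrCA mulrDl mulfK//; exact: addrC.
rewrite /F big_ord_recl/= E expr0 divr1 phiDnat E -mulrA.
rewrite (eq_bigr (fun k : 'I_n => normc (phi ((y + j%:R) / b%:R ^+ k.+1)))) // => k _.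
by rewrite E.
Qed.

Lemma phi_l1_bound n : (forall x, 0 <= x < 1 -> 1 <= w x) ->
  \sum_(k < b ^ n) \prod_(i < n) normc (phi (k%:R / b%:R ^+ i.+1))
    <= Lam ^+ n * w 0.
Proof.
move=> w1; apply: le_trans (transfer_iter n (x := 0) _); last by rewrite lexx/=.
apply: ler_sum => k _.
rewrite -[leLHS]mulr1; apply: ler_pM => //.
- by apply: prodr_ge0 => i _; exact: normc_ge0.
- by under [leRHS]eq_bigr do rewrite add0r.
- apply: w1; rewrite add0r divr_ge0 ?exprn_ge0//= ltr_pdivrMr ?exprn_gt0 ?ltr0n//.
  by rewrite mul1r -natrX ltr_nat.
Qed.
End Transfer.

Lemma sqr_normc_phi t : normc (phi t) ^+ 2 =
  \sum_(d in D) \sum_(d' in D) complex.Re (ex ((d%:R - d'%:R) * t)).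
Proof.
have ReE : complex.Re (phi t) = \sum_(d in D) cos (2 * pi * (d%:R * t)).
  by rewrite /phi; apply: (big_morph (@complex.Re R)) => // -[? ?] [? ?].
have ImE : complex.Im (phi t) = \sum_(d in D) sin (2 * pi * (d%:R * t)).
  by rewrite /phi; apply: (big_morph (@complex.Im R)) => // -[? ?] [? ?].
rewrite sqr_normc_def ReE ImE !expr2 !big_distrlr/= -big_split/=.
apply: eq_bigr => d _; rewrite -big_split/=; apply: eq_bigr => d' _.
by rewrite mulrBl mulrBr cosB.
Qed.

Lemma ex_neq1 t : 0 < t < 1 -> ex t != 1.
Proof.
move=> /andP[t0 t1]; apply/eqP => -[E _].
have : 0 < sin (pi * t).
  by apply: sin_gt0_pi; rewrite mulr_gt0 ?pi_gt0//= gtr_pMr ?pi_gt0.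
move: E; have -> : 2 * pi * t = (pi * t) *+ 2 by rewrite mulr2n; ring.
rewrite cos_mulr2n; have := cos2Dsin2 (pi * t); rewrite -mulr_natr; nra.
Qed.

Lemma sum_ex_eq0 (h : int) x : (0 < `|h|%N < b)%N ->
  \sum_(i < b) ex (h%:~R * ((x + i%:R) / b%:R)) = 0.
Proof.
move=> /andP[h0 hb].
have b0 : b%:R != 0 :> R by rewrite pnatr_eq0 -lt0n (leq_trans _ hb).
pose z := ex (h%:~R / b%:R : R).
have z1 : z - 1 != 0.
  rewrite subr_eq0; have [hh|hh] := leP 0 h.
    apply: ex_neq1; rewrite -(gez0_abs hh) pmulrn.
    rewrite divr_gt0 ?ltr0n ?(leq_trans _ hb)//=.
    by rewrite ltr_pdivrMr ?ltr0n ?(leq_trans _ hb)// mul1r ltr_nat.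
  apply/eqP => zE; have /eqP : ex (- (h%:~R / b%:R)) = 1 :> R[i].
    by have := exN (h%:~R / b%:R : R); rewrite -/z zE mulr1.
  apply/negP; apply: ex_neq1; rewrite -mulNr -mulrNz -(ltz0_abs hh) pmulrn.
  rewrite divr_gt0 ?ltr0n ?(leq_trans _ hb)//=.
  by rewrite ltr_pdivrMr ?ltr0n ?(leq_trans _ hb)// mul1r ltr_nat.
apply: (mulfI z1); rewrite mulr0.
have -> : \sum_(i < b) ex (h%:~R * ((x + i%:R) / b%:R))
   = ex (h%:~R * (x / b%:R)) * \sum_(i < b) z ^+ i.
  rewrite mulr_sumr; apply: eq_bigr => i _.
  by rewrite -exX -exD; congr ex; field.
have zb : z ^+ b = 1 by rewrite /z -exX mulrC divfK// ex_int.
by rewrite mulrCA -subrX1 zb subrr mulr0.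
Qed.

Lemma phi_parseval x :
  \sum_(i < b) normc (phi ((x + i%:R) / b%:R)) ^+ 2 = b%:R * #|D|%:R.
Proof.
under eq_bigr do rewrite sqr_normc_phi.
rewrite exchange_big/=.
rewrite (eq_bigr (fun=> b%:R)); first by rewrite sumr_const mulr_natr.
move=> d dD; rewrite exchange_big/= (bigD1 d)//= [X in _ + X]big1 => [|d' /andP[_ dd']].
  rewrite addr0 (eq_bigr (fun=> 1)); first by rewrite sumr_const card_ord.
  by move=> i _; rewrite subrr mul0r mulr0 cos0.
have := @sum_ex_eq0 (d%:Z - d'%:Z) x.
have -> : (0 < `|d%:Z - d'%:Z| < b)%N.
  have := ltn_ord d; have := ltn_ord d'; move: dd'; rewrite -val_eqE/=.
  by move=> /eqP; lia.
move=> /(_ isT)/(congr1 (@complex.Re R)).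
rewrite (big_morph (@complex.Re R) (id1 := 0) (op1 := +%R)) => [||//]; last first.
  by move=> [? ?] [? ?].
by rewrite rmorphB.
Qed.

End DigitTransform.

(** * Large bases, b >= 18 *)

Lemma sum_sqr_centered (R : realType) (b : nat) (a : R) :
  \sum_(d < b) (2 * d%:R - a) ^+ 2 =
    2 / 3 * (b%:R - 1) * b%:R * (2 * b%:R - 1)
    - 2 * a * b%:R * (b%:R - 1) + b%:R * a ^+ 2.
Proof.
(* The centre [a] is kept free because its intended value b - 1 would move during this induction. *)
elim: b => [|b IH]; first by rewrite big_ord0; ring.
by rewrite big_ord_recr/= IH -natr1; field.
Qed.

Section LargeBase.
Context {R : realType} (b : nat) (D : {set 'I_b}).
Hypothesis cD : #|D| = b.-1.
Hypothesis b18 : (18 <= b)%N.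
Implicit Types s x : R.

Local Lemma card_digitsR : #|D|%:R = b%:R - 1 :> R.
Proof. by rewrite cD -subn1 natrB//; exact: leq_trans b18. Qed.

Local Lemma base_ge18 : 18 <= b%:R :> R.
Proof. by rewrite ler_nat. Qed.

(** Rotating by exp(-2 i pi c s) centres the phases at the mean digit c = (b-1)/2 without changing
    the modulus; then cos u >= 1 - u^2/2 applies termwise. Restoring the missing digit in the sum of
    squares only lowers the bound, and 1 - 32/75 > 57/100. *)
Lemma normc_phi_ge s : `|s| <= (2 * b%:R)^-1 ->
  57 / 100 * b%:R - 1 <= normc (phi D s).
Proof.
move=> hs; have b0 := base_ge18.
pose c : R := (b%:R - 1) / 2.
have -> : normc (phi D s) = normc (ex (- (c * s)) * phi D s).
  by rewrite Normc.normcM normc_ex mul1r.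
apply: le_trans (Re_le_normc _); rewrite /phi mulr_sumr.
rewrite (big_morph (@complex.Re R) (id1 := 0) (op1 := +%R)) => [||//]; last first.
  by move=> [? ?] [? ?].
under eq_bigr do rewrite -exD Re_ex.
have s2 : (2 * pi * s) ^+ 2 <= (16 / 5 / b%:R) ^+ 2.
  rewrite -real_normK ?num_real//.
  rewrite lerXn2r ?nnegrE ?normr_ge0 ?divr_ge0//.
  rewrite normrM ger0_norm ?mulr_ge0 ?pi_ge0//.
  have := @pi_lt_16_5 R; have := pi_gt0 R.
  move: hs; rewrite invfM => hs p0 p1.
  have bi : 0 < (b%:R : R)^-1 by rewrite invr_gt0; lra.
  have := normr_ge0 s; nra.
apply: le_trans (_ : \sum_(d in D) (1 - (2 * d%:R - (b%:R - 1)) ^+ 2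
   * ((16 / 5 / b%:R) ^+ 2 / 8)) <= _); last first.
  apply: ler_sum => d _; apply: le_trans (cos_ge_sqr _).
  rewrite lerD2l lerN2 /c.
  have -> : (2 * pi * (- ((b%:R - 1) / 2 * s) + d%:R * s)) ^+ 2 / 2
    = (2 * d%:R - (b%:R - 1)) ^+ 2 * ((2 * pi * s) ^+ 2 / 8) by field.
  by rewrite ler_wpM2l ?sqr_ge0// ler_pM2r// invr_gt0.
rewrite big_split/= sumr_const card_digitsR sumrN -mulr_suml.
apply: le_trans (_ : b%:R - 1 - (\sum_(d < b) (2 * d%:R - (b%:R - 1)) ^+ 2)
   * ((16 / 5 / b%:R) ^+ 2 / 8) <= _).
  rewrite sum_sqr_centered.
  set B : R := b%:R in b0 *.
  have -> : B - 1 - (2 / 3 * (B - 1) * B * (2 * B - 1) - 2 * (B - 1) * B * (B - 1) + B * (B - 1) ^+ 2) * ((16 / 5 / B) ^+ 2 / 8)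
    = B - 1 - 32 / 75 * (B - B^-1).
    by field; rewrite lt0r_neq0//; lra.
  have : 0 < B^-1 by rewrite invr_gt0; lra.
  lra.
rewrite lerD2l lerN2 ler_wpM2r ?divr_ge0 ?sqr_ge0//.
rewrite [leRHS](bigID (mem D))/= lerDl sumr_ge0// => d _; exact: sqr_ge0.
Qed.

(* One term is of order b; AM-GM with weight 0.85 sqrt b against Parseval
   handles the others. *)
Lemma phi_l1_large x : 0 <= x < 1 ->
  \sum_(i < b) normc (phi D ((x + i%:R) / b%:R))
    <= 199 / 200 * (b%:R - 1) * Num.sqrt b%:R.
Proof.
move=> /andP[x0 x1]; have b0 := base_ge18.
have bn0 : (0 < b)%N by exact: leq_trans b18.
pose F (i : 'I_b) := normc (phi D ((x + i%:R) / b%:R)).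
have [i0 Fi0] : exists i0, 57 / 100 * b%:R - 1 <= F i0.
  (* The point (x+i)/b closest to an integer is the first one if x <= 1/2, otherwise the last one,
     which is (x-1)/b modulo 1. *)
  have [xh|xh] := leP x (1 / 2).
    exists (Ordinal bn0); apply: normc_phi_ge => /=.
    rewrite addr0 ger0_norm ?divr_ge0// invfM ler_pM2r ?invr_gt0; lra.
  have bp : (b.-1 < b)%N by rewrite prednK.
  exists (Ordinal bp); rewrite /F/=.
  have -> : (x + b.-1%:R) / b%:R = (x - 1) / b%:R + 1%:R.
    by rewrite -subn1 natrB//; field; rewrite lt0r_neq0//; lra.
  rewrite phiDnat; apply: normc_phi_ge.
  rewrite normrM (ler0_norm (_ : x - 1 <= 0)); last lra.
  rewrite ger0_norm ?invr_ge0// invfM ler_pM2r ?invr_gt0; lra.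
have := phi_parseval D x; rewrite card_digitsR.
rewrite (bigD1 i0)//= -/(F i0) => Pars.
rewrite (bigD1 i0)//= -/(F i0).
set be := Num.sqrt b%:R.
have be2 : be ^+ 2 = b%:R by rewrite sqr_sqrtr.
have be0 : 0 <= be by rewrite sqrtr_ge0.
have be4 : 21 / 5 <= be by rewrite -(@ler_pXn2r _ 2)// ?nnegrE// be2; lra.
pose g := 17 / 20 * be.
have g0 : 0 < g by rewrite /g; lra.
have AG (y : R) : y <= (2 * g)^-1 * y ^+ 2 + g / 2.
  rewrite -subr_ge0.
  have -> : (2 * g)^-1 * y ^+ 2 + g / 2 - y = (2 * g)^-1 * (y - g) ^+ 2.
    by field; rewrite lt0r_neq0.
  by rewrite mulr_ge0 ?sqr_ge0// invr_ge0; lra.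
apply: le_trans (_ : F i0 + ((2 * g)^-1 * (b%:R * (b%:R - 1) - F i0 ^+ 2)
   + (b%:R - 1) * (g / 2)) <= _).
  rewrite lerD2l -Pars addrAC subrr add0r mulr_sumr.
  have -> : (b%:R - 1) * (g / 2) = \sum_(i < b | i != i0) (g / 2).
    by rewrite -card_digitsR cD sumr_const cardC1 card_ord mulr_natl.
  by rewrite -big_split/=; apply: ler_sum => i _; exact: AG.
set u := F i0 in Fi0 *.
have gE : (2 * g)^-1 = 10 / 17 * be^-1.
  by rewrite /g; field; rewrite lt0r_neq0//; lra.
have bei : be^-1 * be = 1 by rewrite mulVf// lt0r_neq0//; lra.
rewrite gE -be2 /g.
rewrite -be2 in Fi0.
have bi0 : 0 < be^-1 by rewrite invr_gt0; lra.
pose u0 := 57 / 100 * be ^+ 2 - 1.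
(* The function u - u^2/(2 g) decreases beyond g, and u0 >= g since sqrt b >= 21/5; so u may be
   replaced by its lower bound u0. *)
have mono : u - 10 / 17 * be^-1 * u ^+ 2 <= u0 - 10 / 17 * be^-1 * u0 ^+ 2.
  rewrite -subr_ge0.
  have -> : u0 - 10 / 17 * be^-1 * u0 ^+ 2 - (u - 10 / 17 * be^-1 * u ^+ 2)
    = (u - u0) * (10 / 17 * be^-1 * (u + u0) - 1) by ring.
  rewrite mulr_ge0 ?subr_ge0//.
  have : 1 <= 10 / 17 * be^-1 * (2 * u0).
    rewrite /u0 -(ler_pM2r (lt_le_trans _ be4 : 0 < be)) ?mul1r; last lra.
    have -> : 10 / 17 * be^-1 * (2 * (57 / 100 * be ^+ 2 - 1)) * be
      = 20 / 17 * (57 / 100 * be ^+ 2 - 1) * (be^-1 * be) by ring.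
    rewrite bei mulr1; nra.
  have : 0 <= be^-1 * (u - u0) by rewrite mulr_ge0 ?subr_ge0// ltW.
  nra.
apply: le_trans (_ : u0 - 10 / 17 * be^-1 * u0 ^+ 2
  + 10 / 17 * (be^-1 * be) * be * (be ^+ 2 - 1) + (be ^+ 2 - 1) * (17 / 20 * be / 2) <= _).
  move: mono; nra.
rewrite bei /u0.
have -> : 57 / 100 * be ^+ 2 - 1 - 10 / 17 * be^-1 * (57 / 100 * be ^+ 2 - 1) ^+ 2
   = 57 / 100 * be ^+ 2 - 1 - 10 / 17 * ((be^-1 * be) * ((57/100) ^+ 2 * be ^+ 3 - 57 / 50 * be) + be^-1).
  by field; rewrite lt0r_neq0//; lra.
rewrite bei.
nra.
Qed.
End LargeBase.

(** * Integer-arithmetic checker for small bases *)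

Section IntegerArithmetic.
Local Open Scope Z_scope.

(** Fixed-point units: 2^20 for the table of roots of unity, 2^40 for the cosine enclosures that
    certify it. *)
Definition scale : Z := 1048576.
Definition scale2 : Z := 1099511627776.

Definition mulZ2 (z w : Z * Z) : Z * Z :=
  ((z.1 * w.1 - z.2 * w.2) / scale, (z.1 * w.2 + z.2 * w.1) / scale).

(* Binary trie indexed by the bits of a number, least significant bit first;
   the bits beyond the depth are ignored, so indices are taken modulo a power
   of two. *)
Inductive trie := Leaf of Z * Z | Node of trie & trie.

(** Each bit equal to 1 multiplies by the root attached to it, so the entry at n is a product of
    dyadic roots. With at most one rounded product per level, errors grow with the number of bits
    and not with n. *)
Fixpoint trie_of (ws : seq (Z * Z)) (z : Z * Z) : trie :=
  if ws is w :: ws' then Node (trie_of ws' z) (trie_of ws' (mulZ2 z w))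
  else Leaf z.

Fixpoint trie_fst (t : trie) : Z * Z :=
  match t with Leaf z => z | Node l _ => trie_fst l end.

Fixpoint trie_pos (t : trie) (p : positive) : Z * Z :=
  match t with
  | Leaf z => z
  | Node l r => match p with
      | xO p => trie_pos l p
      | xI p => trie_pos r p
      | xH => trie_fst r
      end
  end.

Definition trie_get (t : trie) (n : Z) : Z * Z :=
  if n is Zpos p then trie_pos t p else trie_fst t.

(* [scale * exp(2 i pi / 2^(k+1))], rounded, for k = 0, ..., 10 *)
Definition dyadic_roots : seq (Z * Z) :=
  [:: (-1048576, 0); (0, 1048576); (741455, 741455); (968758, 401273);
      (1028428, 204567); (1043527, 102778); (1047313, 51451);
      (1048260, 25733); (1048497, 12868); (1048556, 6434); (1048571, 3217)].

(** The tolerance is 7/10 of a unit per coordinate: as 2 (7/10)^2 < 1, the complex entry is then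
    within distance 1. The factor 10 clears the denominator. *)
Definition near (l h a : Z) : bool :=
  (10 * scale * h <=? (10 * a + 7) * scale2)
  && ((10 * a - 7) * scale2 <=? 10 * scale * l).

(* Iterates the half-angle formulas on an enclosure [l, h] of
   [scale2 * cos x]. *)
Fixpoint check_roots (ws : seq (Z * Z)) (l h : Z) : bool :=
  if ws is w :: ws' then
    let l' := Z.sqrt (scale2 * (scale2 + l) / 2) in
    let h' := Z.sqrt (scale2 * (scale2 + h) / 2 + 1) + 1 in
    let ls := Z.sqrt (scale2 * (scale2 - h) / 2) in
    let hs := Z.sqrt (scale2 * (scale2 - l) / 2 + 1) + 1 in
    [&& near l' h' w.1, near ls hs w.2 & check_roots ws' l' h']
  else true.

(** [dyadic_roots] begins with the half turn while the trie reads the least significant bit first,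
    hence the reversal; index n stands for exp(2 i pi n / 2048). *)
Definition root_table : trie := trie_of (rev dyadic_roots) (scale, 0).

Definition sumZ (s : seq Z) : Z := foldr Z.add 0 s.

Definition phi_approx (D : seq Z) (g : Z) : Z * Z :=
  let zs := [seq trie_get root_table (j * g) | j <- D] in
  (sumZ [seq z.1 | z <- zs], sumZ [seq z.2 | z <- zs]).

(** Error budget in units of 1/[scale]: the Lipschitz constant, with pi < 16/5, times the distance
    1/(2 b J) + 1/4096 from the evaluation point to any point of the cell; 1 for the floor; and the
    table error 44 for each digit. *)
Definition phi_margin (b J : Z) (D : seq Z) : Z :=
  16 * sumZ [seq Z.abs (2 * j - (b - 1)) | j <- D] * (2048 + b * J) * scale
   / (20480 * b * J) + 1 + 44 * Z.of_nat (size D).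

(* Upper bound for [scale * |phi|] on [k / (b J), (k + 1) / (b J)], where m is
   the margin; J is the number of pieces of the step weight. *)
Definition phi_ub (b J : Z) (D : seq Z) (m k : Z) : Z :=
  let z := phi_approx D (((2 * k + 1) * 2048 + b * J) / (2 * b * J)) in
  Z.sqrt (z.1 * z.1 + z.2 * z.2) + 1 + m.

(** For x in cell j among J, the preimage (x+i)/b lies in cell j + i J among b J; adding up the rows
    of length J thus sums over the b preimages. *)
Fixpoint add_rows (b J : nat) (v : seq Z) : seq Z :=
  if b is b'.+1 then
    [seq p.1 + p.2 | p <- zip (take J v) (add_rows b' J (drop J v))]
  else nseq J 0.

(** Repeating each weight b times refines the mesh: fine cell k lies in coarse cell k / b. *)
Definition transferZ (b J : nat) (u w : seq Z) : seq Z :=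
  add_rows b J [seq p.1 * p.2 | p <- zip u (flatten [seq nseq b x | x <- w])].

Definition digits_but (b d : nat) : seq Z :=
  [seq Z.of_nat j | j <- iota 0 b & (j != d)%nat].

Definition phi_ubs (b J d : nat) : seq Z :=
  let D := digits_but b d in
  let m := phi_margin (Z.of_nat b) (Z.of_nat J) D in
  [seq phi_ub (Z.of_nat b) (Z.of_nat J) D m (Z.of_nat k) | k <- iota 0 (b * J)].

(** Two steps of power iteration from a constant, heading for the leading eigenvector of the
    discretised operator. The outcome is only a candidate, judged by [check_transfer]. *)
Definition weightZ (b J : nat) (u : seq Z) : seq Z :=
  let next w := [seq x / scale | x <- transferZ b J u w] in
  next (next (nseq J 1024)).

(** As 990025/1000000 = (199/200)^2, this is 0.995 (b-1) sqrt b in units of 1/[scale], rounded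
    down. *)
Definition radiusZ (b : Z) : Z :=
  Z.sqrt (scale * scale * b * (b - 1) * (b - 1) * 990025 / 1000000).

Definition check_transfer (b J d : nat) : bool :=
  let u := phi_ubs b J d in
  let w := weightZ b J u in
  (size w == J) &&
  all (fun p => (0 <? p.2) && (p.1 <=? radiusZ (Z.of_nat b) * p.2))
    (zip (transferZ b J u w) w).

End IntegerArithmetic.

(** * From integers to reals, with directed rounding *)

Section ZtoR.
Context {R : realType}.

(* Locked, since computing [int_of_Z] on a large literal would build a unary
   number. *)
Fact zr_key : unit. Proof. by []. Qed.
Definition zr (z : Z) : R := locked_with zr_key (int_of_Z z)%:~R.

Lemma zrE z : zr z = (int_of_Z z)%:~R.
Proof. exact: unlock. Qed.

Lemma zrD x y : zr (x + y)%Z = zr x + zr y.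
Proof. by rewrite !zrE -intrD; congr (_%:~R); lia. Qed.

Lemma zrN x : zr (- x)%Z = - zr x.
Proof. by rewrite !zrE -mulrNz; congr (_%:~R); lia. Qed.

Lemma zrB x y : zr (x - y)%Z = zr x - zr y.
Proof. by rewrite !zrE -intrB; congr (_%:~R); lia. Qed.

Lemma zrM x y : zr (x * y)%Z = zr x * zr y.
Proof. by rewrite !zrE -intrM; congr (_%:~R); lia. Qed.

Lemma zr_nat n : zr (Z.of_nat n) = n%:R.
Proof. by rewrite zrE pmulrn; congr (_%:~R); lia. Qed.

Lemma zr_le x y : (zr x <= zr y) = (x <=? y)%Z.
Proof. by rewrite !zrE ler_int; lia. Qed.

Lemma zr_leP x y : (x <= y)%Z -> zr x <= zr y.
Proof. by move=> xy; rewrite zr_le; lia. Qed.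

Lemma zr0 : zr 0 = 0. Proof. by rewrite zrE. Qed.
Lemma zr1 : zr 1 = 1. Proof. by rewrite zrE. Qed.
Lemma zr2 : zr 2 = 2. Proof. by rewrite zrE. Qed.
Lemma zr7 : zr 7 = 7. Proof. by rewrite zrE. Qed.
Lemma zr10 : zr 10 = 10. Proof. by rewrite zrE. Qed.

Lemma zr_gt0 x : (0 <? x)%Z -> 0 < zr x.
Proof. by rewrite ltNge -zr0 zr_le; lia. Qed.

Lemma zr_scale_gt0 : 0 < zr scale. Proof. exact: zr_gt0. Qed.

Lemma zr_scale2_gt0 : 0 < zr scale2. Proof. exact: zr_gt0. Qed.

Lemma scale_gt0 : (0 < scale)%Z. Proof. by []. Qed.

Lemma zr_sum (s : seq Z) : zr (sumZ s) = \sum_(x <- s) zr x.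
Proof.
elim: s => [|x s IH]; first by rewrite big_nil zr0.
by rewrite big_cons -IH -zrD.
Qed.

Lemma zr_div_itv x y : (0 < y)%Z ->
  zr (x / y) * zr y <= zr x < (zr (x / y) + 1) * zr y.
Proof.
move=> y0; rewrite -[1]zr1 -zrD -!zrM zr_le ltNge zr_le.
have := Z.mul_div_le x y y0; have := Z.mul_succ_div_gt x y y0; lia.
Qed.

Lemma zr_sqrt_le (n : Z) (y : R) : 0 <= y -> zr n <= 2 * y ^+ 2 ->
  zr (Z.sqrt (n / 2)) <= y.
Proof.
(* Should rounding make n negative, [Z.sqrt] returns 0 and the bound still holds. *)
move=> y0 ny; have [n0|n0] := Z_lt_le_dec (n / 2) 0.
  by rewrite Z.sqrt_neg// zr0.
rewrite -(@ler_pXn2r _ 2)// ?nnegrE//; last first.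
  by rewrite -zr0 zr_leP//; exact: Z.sqrt_nonneg.
have [h _] := Z.sqrt_spec _ n0; move: h; set k := Z.sqrt _ => h.
have : zr (2 * (k * k)) <= zr n.
  by apply: zr_leP; have := Z.mul_div_le n 2 erefl; lia.
rewrite !zrM zr2 -expr2 => /le_trans/(_ ny).
by rewrite ler_pM2l.
Qed.

Lemma zr_sqrt_ge (n : Z) (y : R) : 0 <= y -> 2 * y ^+ 2 <= zr n ->
  y <= zr (Z.sqrt (n / 2 + 1) + 1).
Proof.
move=> y0 ny.
have n0 : (0 <= n)%Z.
  have : zr 0 <= zr n by apply: le_trans ny; rewrite zr0 mulr_ge0 ?sqr_ge0.
  by rewrite zr_le; lia.
have n1 : (0 <= n / 2)%Z by apply: Z.div_pos.
have n2 : (0 <= n / 2 + 1)%Z by lia.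
have [_ h] := Z.sqrt_spec _ n2; move: h; set k := Z.sqrt _ => h.
have k0 : (0 <= k)%Z by exact: Z.sqrt_nonneg.
rewrite -(@ler_pXn2r _ 2)// ?nnegrE//; last by rewrite -zr0 zr_leP//; lia.
have : zr n <= zr (2 * ((k + 1) * (k + 1))).
  apply: zr_leP; have := Z.mul_succ_div_gt n 2 erefl; lia.
rewrite !zrM zr2 -expr2 => /(le_trans ny).
by rewrite ler_pM2l.
Qed.

End ZtoR.

(** * Accuracy of the table of roots of unity *)

Section RootTable.
Context {R : realType}.
Local Notation zr := (@zr R).

Definition zc (z : Z * Z) : R[i] := (zr z.1 +i* zr z.2)%C.

Definition approximates (e : R) (z : Z * Z) (t : R) :=
  normc (zc z - (zr scale)%:C%C * ex t) <= e.

Lemma normc_real (x : R) : normc x%:C%C = `|x|.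
Proof. by rewrite /= expr0n/= addr0 sqrtr_sqr. Qed.

Lemma normc_le_coord (x y r e : R) : 0 <= e -> 2 * r ^+ 2 <= e ^+ 2 ->
  `|x| <= r -> `|y| <= r -> normc (x +i* y)%C <= e.
Proof.
move=> e0 re xr yr.
rewrite -(@ler_pXn2r _ 2)// ?nnegrE ?normc_ge0// sqr_normc_def/=.
apply: le_trans re; rewrite mulr_natl mulr2n -(real_normK (num_real x)).
rewrite -(real_normK (num_real y)).
by apply: lerD; rewrite lerXn2r// nnegrE (le_trans _ xr).
Qed.

(** Write S for [scale]. The exact product divided by S is off by at most (|z| + S e)/S <= 2 + e,
    because e <= S forces |z| <= 2 S; flooring both coordinates adds at most 2. *)
Lemma mulZ2_approx e z w s t : e <= zr scale ->
  approximates e z s -> approximates 1 w t ->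
  approximates (e + 4) (mulZ2 z w) (s + t).
Proof.
move=> es; rewrite /approximates => hz hw.
have s0 := @zr_scale_gt0 R.
pose S : R[i] := ((zr scale)%:C)%C.
have S0 : S != 0 by rewrite eq_complex/= gt_eqF.
pose E : R[i] := zc (mulZ2 z w) - zc z * zc w / S.
have hE : normc E <= 2.
  have -> : E = ((zr (mulZ2 z w).1 - zr (z.1 * w.1 - z.2 * w.2) / zr scale) +i*
     (zr (mulZ2 z w).2 - zr (z.1 * w.2 + z.2 * w.1) / zr scale))%C.
    apply: (mulIf S0); rewrite /E mulrBl divfK// /zc /S.
    have s1 : zr scale != 0 by rewrite gt_eqF.
    apply/eqP; rewrite eq_complex/= !mulr0 !subr0 !add0r !mulrBl !divfK//.
    by rewrite !(zrB, zrD, zrM) !eqxx.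
  have aux (m : Z) : `|zr (m / scale) - zr m / zr scale| <= 1.
    have /andP[h1 h2] := @zr_div_itv R m scale scale_gt0.
    rewrite -(ler_pM2r s0) mul1r -{2}(gtr0_norm s0) -normrM mulrBl divfK ?gt_eqF//.
    rewrite ler_norml; lra.
  by apply: (@normc_le_coord _ _ 1); [lra | lra | exact: aux | exact: aux].
have -> : zc (mulZ2 z w) - S * ex (s + t)
   = E + (zc z * (zc w - S * ex t) + S * ex t * (zc z - S * ex s)) / S.
  by rewrite exD /E; field.
apply: le_trans (le_normcD _ _) _.
have hz2 : normc (zc z) <= 2 * zr scale.
  have -> : zc z = (zc z - S * ex s) + S * ex s by rewrite subrK.
  apply: le_trans (le_normcD _ _) _.
  by rewrite (Normc.normcM S) normc_ex normc_real gtr0_norm// mulr1; lra.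
rewrite Normc.normcM Normc.normcV normc_real gtr0_norm//.
have : normc (zc z * (zc w - S * ex t) + S * ex t * (zc z - S * ex s))
   <= (2 + e) * zr scale.
  apply: le_trans (le_normcD _ _) _.
  rewrite !Normc.normcM normc_ex normc_real gtr0_norm// mulr1 mulrDl.
  apply: lerD; last by rewrite mulrC ler_wpM2r// ltW.
  by rewrite -[leRHS]mulr1 ler_pM ?normc_ge0.
rewrite -ler_pdivrMr// => h; lra.
Qed.

Lemma half_angle (t : R) : 0 <= t <= 1 / 2 ->
  [/\ 0 <= cos (2 * pi * (t / 2)), 0 <= sin (2 * pi * (t / 2)) &
      cos (2 * pi * t) = 2 * cos (2 * pi * (t / 2)) ^+ 2 - 1].
Proof.
move=> /andP[t0 t1]; have p0 := pi_gt0 R; split.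
- by apply: cos_ge0_pihalf; apply/andP; split; nra.
- by apply: sin_ge0_pi; apply/andP; split; nra.
- by rewrite [2 * _ ^+ 2]mulr_natl -cos_mulr2n; congr cos; rewrite mulr2n; field.
Qed.

Lemma half_angle_enclosure (S l h c s : R) : 0 < S -> c ^+ 2 + s ^+ 2 = 1 ->
  l <= S * (2 * c ^+ 2 - 1) <= h ->
  [/\ S * (S + l) <= 2 * (S * c) ^+ 2, 2 * (S * c) ^+ 2 <= S * (S + h),
      S * (S - h) <= 2 * (S * s) ^+ 2 & 2 * (S * s) ^+ 2 <= S * (S - l)].
Proof.
move=> S0 cs /andP[lc hc].
have -> : 2 * (S * c) ^+ 2 = S * (S + S * (2 * c ^+ 2 - 1)) by ring.
have -> : 2 * (S * s) ^+ 2 = S * (S - S * (2 * c ^+ 2 - 1)).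
  have s2 : s ^+ 2 = 1 - c ^+ 2 by rewrite -cs; ring.
  by rewrite exprMn s2; ring.
by rewrite !ler_pM2l// !lerD2l !lerN2.
Qed.

Lemma near_dist (lo hi a : Z) (x : R) : near lo hi a ->
  zr lo <= zr scale2 * x -> zr scale2 * x <= zr hi ->
  `|zr a - zr scale * x| <= 7 / 10.
Proof.
have := @zr_scale2_gt0 R; have := @zr_scale_gt0 R.
rewrite /near -!(@zr_le R) !(zrM, zrD, zrB) zr10 zr7.
move: (zr scale) (zr scale2) (zr a) (zr lo) (zr hi) => s S A lo' hi'.
move=> s0 S0 /andP[n3 n4] lx hx.
have h1 : S * (A - s * x) <= S * (7 / 10) by nra.
have h2 : S * (- (7 / 10)) <= S * (A - s * x) by nra.
by move: h1 h2; rewrite !ler_pM2l// ler_norml => -> ->.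
Qed.

Lemma check_roots_cons w ws l h : check_roots (w :: ws) l h =
  (let l' := Z.sqrt (scale2 * (scale2 + l) / 2) in
   let h' := Z.sqrt (scale2 * (scale2 + h) / 2 + 1) + 1 in
   let ls := Z.sqrt (scale2 * (scale2 - h) / 2) in
   let hs := Z.sqrt (scale2 * (scale2 - l) / 2 + 1) + 1 in
   [&& near l' h' w.1, near ls hs w.2 & check_roots ws l' h'])%Z.
Proof. by []. Qed.

Lemma check_roots_sound ws l h t : 0 <= t <= 1 / 2 ->
  zr l <= zr scale2 * cos (2 * pi * t) <= zr h -> check_roots ws l h ->
  forall k, (k < size ws)%N ->
    approximates 1 (nth (0%Z, 0%Z) ws k) (t / 2 ^+ k.+1).
Proof.
elim: ws l h t => [//|w ws IH] l h t t01 lh.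
rewrite check_roots_cons; cbv zeta => /and3P[n1 n2 chk].
set l' := Z.sqrt _ in n1 chk; set h' := (X in near l' X _) in n1 chk.
set ls := Z.sqrt _ in n2; set hs := (X in near ls X _) in n2.
have S0 := @zr_scale2_gt0 R.
have [c0 sn0 c2] := half_angle t01; rewrite c2 in lh.
have [e1 e2 e3 e4] := half_angle_enclosure S0 (cos2Dsin2 _) lh.
move: c0 sn0 e1 e2 e3 e4.
set c := cos (2 * pi * (t / 2)); set s := sin (2 * pi * (t / 2)) => c0 sn0.
rewrite -!zrD -!zrB -!zrM => e1 e2 e3 e4.
have lc : zr l' <= zr scale2 * c by apply: zr_sqrt_le => //; rewrite mulr_ge0// ltW.
have hc : zr scale2 * c <= zr h' by apply: zr_sqrt_ge => //; rewrite mulr_ge0// ltW.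
have lsc : zr ls <= zr scale2 * s by apply: zr_sqrt_le => //; rewrite mulr_ge0// ltW.
have hsc : zr scale2 * s <= zr hs by apply: zr_sqrt_ge => //; rewrite mulr_ge0// ltW.
have apx : approximates 1 w (t / 2).
  rewrite /approximates.
  have -> : (zc w - (zr scale)%:C * ex (t / 2))%C
      = ((zr w.1 - zr scale * c) +i* (zr w.2 - zr scale * s))%C.
    by apply/eqP; rewrite eq_complex/= !mul0r subr0 addr0 !eqxx.
  apply: (@normc_le_coord _ _ (7 / 10)); [lra | lra | |].
    exact: near_dist n1 lc hc.
  exact: near_dist n2 lsc hsc.
case=> [|k] /= hk; first by rewrite expr1.
have -> : t / 2 ^+ k.+2 = t / 2 / 2 ^+ k.+1 by rewrite exprS invfM mulrA.
apply: IH chk _ hk; last by rewrite lc hc.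
by case/andP: t01 => t0 t1; apply/andP; clear -t0 t1; split; lra.
Qed.

(** The root -1 is exact. As cos pi = -1 is known without error, it also starts the half-angle
    iteration by which [check_roots] certifies the ten other roots. *)
Lemma dyadic_roots_approx k : (k < 11)%N ->
  approximates 1 (nth (0%Z, 0%Z) dyadic_roots k) (1 / 2 ^+ k.+1).
Proof.
case: k => [_|k hk].
  rewrite /approximates (_ : nth _ _ _ = (- scale, 0)%Z)// expr1.
  rewrite (_ : zc _ - _ = 0) ?Normc.normc0//.
  rewrite /zc (_ : (_, _).1 = (- scale)%Z)// zrN (_ : (_, _).2 = 0%Z)// zr0.
  apply/eqP; rewrite eq_complex/= (_ : 2 * pi * (1 / 2) = pi); last by field.
  by rewrite cospi sinpi; apply/andP; split; apply/eqP; ring.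
have E : 1 / 2 ^+ k.+2 = 1 / 2 / 2 ^+ k.+1 :> R by rewrite exprS invfM mulrA.
rewrite E; apply: (@check_roots_sound (behead dyadic_roots) (- scale2) (- scale2)).
- lra.
- rewrite (_ : 2 * pi * (1 / 2) = pi); last by field.
  by rewrite cospi mulrN1 zrN lexx.
- by vm_compute.
- by [].
Qed.

(** The step t doubles at each level and equals 1 at a leaf; the remaining high bits then add an
    integer to the angle, which [ex] does not see. The branch of a bit 0 makes no product, so its
    smaller error is weakened to match the other branch. *)
Lemma trie_of_approx ws z e s t : e + 4 * (size ws)%:R <= zr scale ->
  approximates e z s ->
  (forall k, (k < size ws)%N -> approximates 1 (nth (0%Z, 0%Z) ws k) (2 ^+ k * t)) ->
  2 ^+ size ws * t = 1 ->
  approximates (e + 4 * (size ws)%:R) (trie_fst (trie_of ws z)) s /\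
  forall p, approximates (e + 4 * (size ws)%:R) (trie_pos (trie_of ws z) p)
     (s + zr (Zpos p) * t).
Proof.
elim: ws z e s t => [|w ws IH] z e s t /= he hz hws ht.
  rewrite mulr0 addr0; split => // p.
  move: ht; rewrite expr0 mul1r => ->; rewrite mulr1 /approximates exD.
  by rewrite [zr (Zpos p)]zrE ex_int mulr1.
have S4 : 4 * (size ws).+1%:R = 4 + 4 * (size ws)%:R :> R by rewrite -natr1; ring.
have sz0 : 0 <= 4 * (size ws)%:R :> R by rewrite mulr_ge0.
have hws' k : (k < size ws)%N ->
    approximates 1 (nth (0%Z, 0%Z) ws k) (2 ^+ k * (2 * t)).
  by move=> hk; have := hws k.+1 hk; rewrite /= exprSr mulrA.
have ht' : 2 ^+ size ws * (2 * t) = 1 by rewrite mulrA -exprSr.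
have hw : approximates 1 w t by have := hws 0%N isT; rewrite /= expr0 mul1r.
have weak a b u v : a <= b -> approximates a u v -> approximates b u v.
  by move=> ab; rewrite /approximates => /le_trans; apply.
rewrite S4 addrA.
have he1 : e + 4 * (size ws)%:R <= zr scale by lra.
have he2 : e + 4 + 4 * (size ws)%:R <= zr scale by lra.
have hes : e <= zr scale by lra.
have [A1 A2] := IH z e s (2 * t) he1 hz hws' ht'.
have [B1 B2] := IH _ _ _ (2 * t) he2 (mulZ2_approx hes hz hw) hws' ht'.
split; first by apply: weak A1; lra.
case=> [p|p|] /=.
- have -> : s + zr (Zpos p~1) * t = s + t + zr (Zpos p) * (2 * t).
    have -> : Zpos p~1 = (2 * Zpos p + 1)%Z by [].
    by rewrite zrD zrM zr2 zr1; ring.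
  exact: B2.
- have -> : s + zr (Zpos p~0) * t = s + zr (Zpos p) * (2 * t).
    have -> : Zpos p~0 = (2 * Zpos p)%Z by [].
    by rewrite zrM zr2; ring.
  by apply: weak (A2 p); lra.
- by rewrite zr1 mul1r.
Qed.

(** Here 44 is 4 times 11: the initial value 1 is exact and each of the 11 levels costs at most
    4. *)
Lemma root_table_approx n : (0 <= n)%Z ->
  approximates 44 (trie_get root_table n) (zr n / 2 ^+ 11).
Proof.
move=> n0.
have h : 0 + 4 * (size (rev dyadic_roots))%:R <= zr scale.
  rewrite add0r -natrM -zr_nat; exact: zr_leP.
have hz : approximates 0 (scale, 0%Z) 0.
  rewrite /approximates ex0 mulr1 /zc/= zr0.
  by rewrite !subrr expr0n/= addr0 sqrtr0.
have hws k : (k < size (rev dyadic_roots))%N ->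
    approximates 1 (nth (0%Z, 0%Z) (rev dyadic_roots) k) (2 ^+ k * (1 / 2 ^+ 11)).
  rewrite size_rev => hk; rewrite nth_rev//.
  have -> : 2 ^+ k * (1 / 2 ^+ 11) = 1 / 2 ^+ (11 - k.+1).+1 :> R.
    rewrite subnSK// mulrCA !mul1r -[X in _ / _ ^+ X](subnK (ltnW hk)).
    by rewrite addnC exprD invfM mulVKf// expf_neq0.
  apply: dyadic_roots_approx; exact: ltn_subrL.
have ht : 2 ^+ size (rev dyadic_roots) * (1 / 2 ^+ 11) = 1 :> R.
  by rewrite mulrCA mulfV ?expf_neq0// mulr1.
have [A1 A2] := trie_of_approx h hz hws ht.
have E44 : 0 + 4 * (size (rev dyadic_roots))%:R = 44 :> R.
  by rewrite add0r -natrM.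
rewrite E44 in A1 A2.
case: n n0 => [_|p _|p n0].
- by rewrite zr0 mul0r; exact: A1.
- by have := A2 p; rewrite add0r mul1r; apply.
- by have := Zlt_neg_0 p; lia.
Qed.

End RootTable.

(* The [l^1] dimension of the missing-digit set exceeds 1/2, with a weight w
   witnessing the bound on the spectral radius. *)
Definition transferable (R : realType) (b : nat) (D : {set 'I_b}) : Prop :=
  exists (w : R -> R) (Lam : R),
    [/\ 0 <= Lam, Lam ^+ 2 <= (199 / 200) ^+ 2 * b%:R * (b%:R - 1) ^+ 2,
        forall x, 0 <= x < 1 -> 1 <= w x &
        forall x, 0 <= x < 1 ->
          \sum_(i < b) normc (phi D ((x + i%:R) / b%:R)) * w ((x + i%:R) / b%:R)
            <= Lam * w x].

(** * Soundness of the checker *)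

Section CheckerSoundness.
Context {R : realType}.
Local Notation zr := (@zr R).

(** Recentring the phases at c = (b-1)/2 keeps the modulus and turns the frequencies d into d - c,
    which reduces the Lipschitz constant. *)
Lemma phi_lipschitz (b : nat) (D : {set 'I_b}) (y g : R) :
  normc (phi D y) <= normc (phi D g)
    + pi * (\sum_(d in D) `|2 * d%:R - (b%:R - 1)|) * `|y - g|.
Proof.
pose c : R := (b%:R - 1) / 2.
have C z : normc (phi D z) = normc (\sum_(d in D) ex ((d%:R - c) * z)).
  have -> : \sum_(d in D) ex ((d%:R - c) * z) = ex (- (c * z)) * phi D z.
    rewrite mulr_sumr; apply: eq_bigr => d _; rewrite -exD; congr ex; ring.
  by rewrite Normc.normcM normc_ex mul1r.
rewrite !C; set A := \sum_(d in D) _; set B := \sum_(d in D) ex ((d%:R - c) * g).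
rewrite -[A](subrK B) addrC; apply: le_trans (le_normcD _ _) _.
rewrite lerD2l /A /B -sumrB; apply: le_trans (normc_sum _ _ _) _.
rewrite mulr_sumr mulr_suml; apply: ler_sum => d _.
apply: le_trans (ex_dist _ _) _.
rewrite -mulrBr normrM mulrA ler_wpM2r//.
have -> : d%:R - c = (2 * d%:R - (b%:R - 1)) / 2 by rewrite /c; field.
rewrite normrM (gtr0_norm (_ : 0 < 2^-1)) ?invr_gt0// le_eqVlt; apply/orP; left.
by apply/eqP; field.
Qed.

Lemma zr_abs x : zr (Z.abs x) = `|zr x|.
Proof.
have [x0|x0] := Z_le_gt_dec 0 x.
  by rewrite Z.abs_eq// ger0_norm// -zr0 zr_leP.
rewrite Z.abs_neq; last lia.
by rewrite zrN ler0_norm// -zr0 zr_leP//; lia.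
Qed.

Lemma zr_2048 : zr 2048 = 2 ^+ 11.
Proof. by rewrite -natrX -zr_nat. Qed.

Lemma zr_20480 : zr 20480 = 10 * 2 ^+ 11.
Proof. by rewrite -zr_2048 -zr10 -zrM. Qed.

Lemma zr_25 : zr 25 = 25. Proof. by rewrite zrE. Qed.

Lemma zr_million : zr 1000000 = 25 * 200 ^+ 2.
Proof. by rewrite -[200]zr_nat expr2 -zr_25 -!zrM. Qed.

Lemma zr_990025 : zr 990025 = 25 * 199 ^+ 2.
Proof. by rewrite -[199]zr_nat expr2 -zr_25 -!zrM. Qed.

Lemma zr_16 : zr 16 = 16. Proof. by rewrite zrE. Qed.
Lemma zr_44 : zr 44 = 44. Proof. by rewrite zrE. Qed.

Section OneBase.
Variables (b J d : nat) (D : {set 'I_b}).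
Hypotheses (b0 : (0 < b)%N) (J0 : (0 < J)%N).
Hypothesis DE : forall i : 'I_b, (i \in D) = (i != d :> nat).

Lemma sum_digits_but (V : nmodType) (F : Z -> V) :
  \sum_(j <- digits_but b d) F j = \sum_(i in D) F (Z.of_nat i).
Proof.
rewrite /digits_but big_map big_filter.
rewrite (_ : iota 0 b = index_iota 0 b); last by rewrite /index_iota subn0.
by rewrite big_mkord; apply: eq_bigl => i; rewrite DE.
Qed.

Lemma size_digits_but : (size (digits_but b d))%:R = #|D|%:R :> R.
Proof.
have -> : (size (digits_but b d))%:R = \sum_(j <- digits_but b d) (1 : R).
  by rewrite big_const_seq count_predT -[LHS]addr0; elim: size => [|n IH] /=;
    rewrite -?IH -?natr1 ?addr0 // [1 + _]addrC.
by rewrite sum_digits_but sumr_const.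
Qed.

Lemma phi_approx_sound (g : Z) : (0 <= g)%Z ->
  normc (zc (phi_approx (digits_but b d) g)
     - (zr scale)%:C%C * phi D (zr g / 2 ^+ 11)) <= 44 * #|D|%:R.
Proof.
move=> g0.
have -> : zc (phi_approx (digits_but b d) g)
    = \sum_(i in D) zc (trie_get root_table (Z.of_nat i * g)) :> R[i].
  rewrite -(sum_digits_but (fun j => zc (trie_get root_table (j * g)))).
  rewrite /phi_approx /zc; elim: (digits_but b d) => [|j s IH].
    by rewrite big_nil /= zr0.
  rewrite big_cons -IH; apply/eqP; rewrite eq_complex.
  rewrite /= !zrD !eqxx//.
rewrite /phi mulr_sumr -sumrB; apply: le_trans (normc_sum _ _ _) _.
rewrite mulr_natr -sumr_const; apply: ler_sum => i _.
have := @root_table_approx R (Z.of_nat i * g) _.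
rewrite /approximates zrM zr_nat mulrA; apply; nia.
Qed.

Lemma phi_ub_sound (k : nat) (y : R) :
  k%:R <= y * (b * J)%:R <= k.+1%:R ->
  zr scale * normc (phi D y) <=
    zr (phi_ub (Z.of_nat b) (Z.of_nat J) (digits_but b d)
      (phi_margin (Z.of_nat b) (Z.of_nat J) (digits_but b d)) (Z.of_nat k)).
Proof.
move=> /andP[ky yk]; rewrite /phi_ub; cbv zeta.
set g := Z.div _ _; set z := phi_approx _ _.
have bJ : (0 < b * J)%N by rewrite muln_gt0 b0.
have g0 : (0 <= g)%Z by apply: Z.div_pos; nia.
have s0 := @zr_scale_gt0 R.
have hz := phi_approx_sound g0; rewrite -/z in hz.
set f := zr g / 2 ^+ 11 in hz.
have h1 : zr scale * normc (phi D f) <= normc (zc z : R[i]) + 44 * #|D|%:R.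
  rewrite -[X in X * _](gtr0_norm s0) -normc_real -Normc.normcM.
  have -> : (zr scale)%:C%C * phi D f
    = zc z + - (zc z - (zr scale)%:C%C * phi D f) by ring.
  by apply: le_trans (le_normcD _ _) _; rewrite normcN lerD2l.
have h2 : normc (zc z : R[i]) <= zr (Z.sqrt (z.1 * z.1 + z.2 * z.2) + 1).
  set n := (X in Z.sqrt X); have n0 : (0 <= n)%Z.
    by rewrite /n; move: z.1 z.2; clear => p q; nia.
  have [_ hn] := Z.sqrt_spec _ n0; have q0 := Z.sqrt_nonneg n.
  rewrite -(@ler_pXn2r _ 2)// ?nnegrE ?normc_ge0//; last by rewrite -zr0 zr_leP//; lia.
  rewrite sqr_normc_def [complex.Re _]/= [complex.Im _]/= !expr2 -!zrM -zrD.
  by apply: zr_leP; rewrite -/n; lia.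
(* Adding b J before the division by 2 b J rounds to nearest: g is within half a grid step of the
   midpoint of the cell, and y within half a cell. *)
have dist : `|y - f| <= (2 * (b * J)%:R)^-1 + (2 * 2 ^+ 11)^-1.
  have /andP[] := @zr_div_itv R ((2 * Z.of_nat k + 1) * 2048 + Z.of_nat b * Z.of_nat J)
    (2 * Z.of_nat b * Z.of_nat J) ltac:(nia).
  rewrite -/g !(zrD, zrM, zr_nat, zr2, zr1) zr_2048 -!mulrA -natrM.
  rewrite /f; move: ky yk; rewrite -natr1.
  have B0 : 0 < (b * J)%:R :> R by rewrite ltr0n.
  have L0 : 0 < 2 ^+ 11 :> R by rewrite exprn_gt0.
  move: (b * J)%:R (2 ^+ 11 : R) (zr g) (k%:R : R) B0 L0 => B L G K B0 L0.
  move=> ky yk g1 g2; rewrite -(ler_pM2l (mulr_gt0 B0 L0)).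
  have -> : B * L * ((2 * B)^-1 + (2 * L)^-1) = (L + B) / 2.
    by field; rewrite !gt_eqF.
  rewrite -[X in X * _](gtr0_norm (mulr_gt0 B0 L0)) -normrM.
  have -> : B * L * (y - G / L) = y * B * L - B * G by field; rewrite gt_eqF.
  rewrite ler_norml; nra.
have h3 : zr scale * (pi * (\sum_(i in D) `|2 * i%:R - (b%:R - 1)|) * `|y - f|)
   + 44 * #|D|%:R <= zr (phi_margin (Z.of_nat b) (Z.of_nat J) (digits_but b d)).
  rewrite /phi_margin; set q := Z.div _ _.
  have /andP[_] := @zr_div_itv R (16 * sumZ [seq Z.abs (2 * j - (Z.of_nat b - 1))
      | j <- digits_but b d] * (2048 + Z.of_nat b * Z.of_nat J) * scale)
    (20480 * Z.of_nat b * Z.of_nat J) ltac:(nia).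
  rewrite -/q !(zrD, zrM, zr_nat, zr2, zr1) zr_2048 zr_20480 zr_16 zr_44.
  rewrite size_digits_but lerD2r zr_sum big_map.
  rewrite (sum_digits_but (fun j => zr (Z.abs (2 * j - (Z.of_nat b - 1))))).
  rewrite (eq_bigr (fun i : 'I_b => `|2 * i%:R - (b%:R - 1)|)); last first.
    by move=> i _; rewrite zr_abs !(zrB, zrM, zr_nat, zr2, zr1).
  have A0 : 0 <= \sum_(i in D) `|2 * i%:R - (b%:R - 1)| :> R.
    by apply: sumr_ge0.
  rewrite -![10 * 2 ^+ 11 * _ * _]mulrA -!natrM => hq.
  have B0 : 0 < (b * J)%:R :> R by rewrite ltr0n.
  have L0 : 0 < 2 ^+ 11 :> R by rewrite exprn_gt0.
  apply: le_trans (_ : zr scale * (16 / 5 * (\sum_(i in D) `|2 * i%:R - (b%:R - 1)|)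
     * ((2 * (b * J)%:R)^-1 + (2 * 2 ^+ 11)^-1)) <= _).
    rewrite ler_pM2l// ler_pM ?mulr_ge0 ?pi_ge0// ler_wpM2r//.
    exact: ltW (@pi_lt_16_5 R).
  move: (\sum_(i in D) _) A0 hq; move: (b * J)%:R (2 ^+ 11 : R) (zr q) (zr scale) B0 L0.
  move=> B L Q S B0 L0 A A0 hq.
  have -> : S * (16 / 5 * A * ((2 * B)^-1 + (2 * L)^-1))
     = 16 * A * (L + B) * S / (10 * (L * B)) by field; rewrite !gt_eqF.
  rewrite ler_pdivrMr ?mulr_gt0//; lra.
have := phi_lipschitz D y f; rewrite -(ler_pM2l s0) mulrDr => h4.
rewrite zrD; lra.
Qed.

Lemma size_add_rows n v : size v = (n * J)%N -> size (add_rows n J v) = J.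
Proof.
elim: n v => [|n IH] v sv; first by rewrite size_nseq.
rewrite /= size_map size_zip IH ?size_drop ?sv ?mulSn ?addKn//.
by rewrite size_takel ?minnn// sv mulSn leq_addr.
Qed.

Lemma nth_add_rows (n : nat) (v : seq Z) (j : nat) : size v = (n * J)%N ->
  (j < J)%N -> zr (nth 0%Z (add_rows n J v) j) = \sum_(i < n) zr (nth 0%Z v (j + i * J)).
Proof.
elim: n v => [|n IH] v sv jJ; first by rewrite big_ord0 /= nth_nseq jJ zr0.
have sd : size (drop J v) = (n * J)%N by rewrite size_drop sv mulSn addKn.
have st : size (take J v) = J by rewrite size_takel// sv mulSn leq_addr.
rewrite [add_rows _ _ _]/= (nth_map (0%Z, 0%Z)).
  rewrite nth_zip ?st ?size_add_rows//.
  rewrite zrD IH// big_ord_recl/= mul0n addn0 nth_take//.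
  congr (_ + _); apply: eq_bigr => i _.
  by rewrite nth_drop/= /bump/= add1n mulSn addnCA.
by rewrite size_zip st size_add_rows// minnn.
Qed.

Lemma nth_flatten_nseq (w : seq Z) k : (k < size w * b)%N ->
  nth 0%Z (flatten [seq nseq b x | x <- w]) k = nth 0%Z w (k %/ b).
Proof.
elim: w k => [|x w IH] k; first by rewrite mul0n.
rewrite /= nth_cat size_nseq => hk.
have [kb|kb] := ltnP k b; first by rewrite nth_nseq kb divn_small.
rewrite IH; last by move: hk; rewrite mulSn; lia.
by rewrite -[in RHS](subnK kb) divnDr ?divnn ?b0 ?addn1.
Qed.

Lemma check_transfer_sound : check_transfer b J d -> transferable R D.
Proof.
rewrite /check_transfer; cbv zeta.
set u := phi_ubs b J d; set W := weightZ b J u => /andP[/eqP sW /allP hall].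
have s0 := @zr_scale_gt0 R.
have su : size u = (b * J)%N by rewrite size_map size_iota.
pose v := [seq p.1 * p.2 | p <- zip u (flatten [seq nseq b x | x <- W])]%Z.
have sf : size (flatten [seq nseq b x | x <- W]) = (b * J)%N.
  by rewrite size_flatten /shape -map_comp -sW; elim: (W) => [|x s IH] /=;
    rewrite ?muln0// IH size_nseq mulnS.
have sv : size v = (b * J)%N by rewrite size_map size_zip su sf minnn.
have nv k : (k < b * J)%N -> nth 0%Z v k = (nth 0%Z u k * nth 0%Z W (k %/ b))%Z.
  move=> hk; rewrite (nth_map (0%Z, 0%Z)) ?size_zip ?su ?sf ?minnn//.
  by rewrite nth_zip ?su ?sf//= nth_flatten_nseq// sW mulnC.
have sT : size (transferZ b J u W) = J by exact: size_add_rows.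
have chk j : (j < J)%N -> (0 < nth 0%Z W j)%Z /\
    (nth 0%Z (transferZ b J u W) j <= radiusZ (Z.of_nat b) * nth 0%Z W j)%Z.
  move=> jJ; have := hall (nth 0%Z (transferZ b J u W) j, nth 0%Z W j).
  rewrite -nth_zip ?sT ?sW// => /(_ _)/wrap[].
    by apply: mem_nth; rewrite size_zip sT sW minnn.
  rewrite nth_zip ?sT ?sW//= => /andP[]; lia.
pose idx (x : R) := Num.truncn (x * J%:R).
have idxP x : 0 <= x < 1 -> (idx x < J)%N /\ (idx x)%:R <= x * J%:R < (idx x).+1%:R.
  move=> /andP[x0 x1]; have xJ : 0 <= x * J%:R by rewrite mulr_ge0.
  split; last exact: truncn_itv.
  by rewrite truncn_lt_nat// gtr_pMl// ltr0n.
(* The step function of the checked integer vector. Its entries are positive integers, whence w >=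
   1. *)
pose w x : R := zr (nth 0%Z W (idx x)).
exists w, (zr (radiusZ (Z.of_nat b)) / zr scale); split.
- by rewrite divr_ge0 ?(ltW s0)// -zr0 zr_leP//; exact: Z.sqrt_nonneg.
- rewrite expr_div_n ler_pdivrMr ?exprn_gt0// /radiusZ; set M := (_ * _)%Z.
  have M0 : (0 <= M / 1000000)%Z.
    have := scale_gt0 => s0'; apply: Z.div_pos => //.
    by rewrite /M; do 5 (apply: Z.mul_nonneg_nonneg; last by lia); lia.
  have [hr _] := Z.sqrt_spec _ M0.
  have h : (Z.sqrt (M / 1000000) * Z.sqrt (M / 1000000) * 1000000 <= M)%Z.
    by have := Z.mul_div_le M 1000000 erefl; lia.
  have := @zr_leP R _ _ h; rewrite /M !(zrM, zrB, zr_nat) zr1 zr_million zr_990025.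
  move: (zr (Z.sqrt _)) (zr scale) (b%:R : R) => r S B; nra.
- move=> x /idxP[xJ _]; have [h _] := chk _ xJ.
  by rewrite /w -zr1 zr_leP//; lia.
move=> x x01; have [xJ /andP[x1 x2]] := idxP x x01.
have [_ hj] := chk _ xJ; set j := idx x in xJ x1 x2 hj *.
rewrite mulrAC ler_pdivlMr// mulr_suml.
apply: le_trans (_ : zr (nth 0%Z (transferZ b J u W) j) <= _); last first.
  by rewrite /w -zrM zr_leP.
rewrite /transferZ -/v nth_add_rows//; apply: ler_sum => i _.
have kJ : (j + i * J < b * J)%N.
  have := ltn_ord i; rewrite -(leq_pmul2r J0) mulSn; lia.
have bR : 0 < b%:R :> R by rewrite ltr0n.
have JR : 0 < J%:R :> R by rewrite ltr0n.
have E : (x + i%:R) / b%:R * (b * J)%:R = x * J%:R + (i * J)%:R.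
  by rewrite !natrM; field; rewrite gt_eqF.
have idxE : idx ((x + i%:R) / b%:R) = ((j + i * J) %/ b)%N.
  have E2 : (x + i%:R) / b%:R * J%:R * b%:R = x * J%:R + (i * J)%:R.
    by rewrite natrM; field; rewrite gt_eqF.
  rewrite -natr1 in x2.
  apply: truncn_def; rewrite -(ler_pM2r bR) -(ltr_pM2r bR) E2 -!natrM.
  apply/andP; split.
    have := leq_trunc_div (j + i * J) b; rewrite -(ler_nat R) natrD; lra.
  have : (j + i * J < ((j + i * J) %/ b).+1 * b)%N by rewrite -ltn_divLR.
  rewrite -(ler_nat R) -natr1 natrD; lra.
have wk0 : 0 <= zr (nth 0%Z W ((j + i * J) %/ b)).
  have : ((j + i * J) %/ b < J)%N by rewrite ltn_divLR// [(J * b)%N]mulnC.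
  by move=> /chk[h _]; rewrite -zr0 zr_leP//; lia.
have wE : w ((x + i%:R) / b%:R) = zr (nth 0%Z W ((j + i * J) %/ b)).
  by rewrite /w idxE.
rewrite nv// wE zrM mulrAC ler_wpM2r// [leLHS]mulrC.
rewrite (nth_map 0%N) ?size_iota// nth_iota// add0n.
apply: phi_ub_sound; rewrite E natrD -natr1 natrD.
by rewrite -natr1 in x2; apply/andP; split; lra.
Qed.

End OneBase.
End CheckerSoundness.

(** * Running the checker: base 4, and bases 5 to 17 with every missing digit *)

Definition mesh (b : nat) : nat := if (b <= 6)%N then 128 else if (b <= 8)%N then 32 else 16.

Lemma check_transfer4 : check_transfer 4 128 0 && check_transfer 4 128 3.
Proof. by vm_cast_no_check (erefl true). Qed.

Lemma check_transfer_mid :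
  all (fun b => all (check_transfer b (mesh b)) (iota 0 b)) (iota 5 13).
Proof. by vm_cast_no_check (erefl true). Qed.

Lemma admissible_base b (D : {set 'I_b}) : admissible D -> (4 <= b)%N.
Proof. by move=> [_ [[h _]|[b4 _]]]; [exact: ltnW | rewrite b4]. Qed.

Lemma admissible_card b (D : {set 'I_b}) : admissible D -> #|D| = b.-1.
Proof.
move=> [_ [[_ ->//]|[b4]]]; subst b => -[->|->].
- have -> : [set a : 'I_4 | (a : nat) \in [:: 1; 2; 3]%N]%SET = [set~ ord0]%SET.
    by apply/setP => i; rewrite !inE; case: i => -[|[|[|[|]]]].
  by rewrite cardsC1 card_ord.
- have -> : [set a : 'I_4 | (a : nat) \in [:: 0; 1; 2]%N]%SET = [set~ ord_max]%SET.
    by apply/setP => i; rewrite !inE; case: i => -[|[|[|[|]]]].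
  by rewrite cardsC1 card_ord.
Qed.

Lemma transfer_exists (R : realType) b (D : {set 'I_b}) :
  admissible D -> transferable R D.
Proof.
move=> aD; have cD := admissible_card aD; have b4 := admissible_base aD.
have b0 : (0 < b)%N by exact: leq_trans b4.
have [b18|b18] := leqP 18 b.
  exists (fun=> 1), (199 / 200 * (b%:R - 1) * Num.sqrt b%:R).
  have b1 : 0 <= b%:R - 1 :> R by rewrite subr_ge0 ler1n.
  have t0 : 0 <= 199 / 200 :> R by lra.
  split.
  - exact: mulr_ge0 (mulr_ge0 t0 b1) (sqrtr_ge0 _).
  - by rewrite !exprMn sqr_sqrtr// mulrAC.
  - by [].
  - move=> x x01; rewrite mulr1; under eq_bigr do rewrite mulr1.
    exact: phi_l1_large.
have [b5|b5] := leqP 5 b.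
  have /cards1P[d dE] : #|~: D| == 1%N.
    by rewrite cardsCs finset.setCK card_ord cD; apply/eqP; case: (b) b0 => // n _ /=; rewrite subSnn.
  have chk : check_transfer b (mesh b) d.
    have /allP/(_ b) := check_transfer_mid; rewrite mem_iota b5 b18 => /(_ isT).
    by move=> /allP; apply; rewrite mem_iota/=.
  apply: (check_transfer_sound b0 _ _ chk).
  - by rewrite /mesh; case: ifP => // _; case: ifP.
  - move=> i; have : (i \in ~: D) = (i == d) by rewrite dE inE.
    by rewrite inE -val_eqE => <-; rewrite negbK.
have bE : b = 4%N by apply/eqP; rewrite eqn_leq b4 andbT.
have [H0 H3] :
    (forall E : {set 'I_4}, (forall i, (i \in E) = (i != 0 :> nat)) ->
       transferable R E) /\
    (forall E : {set 'I_4}, (forall i, (i \in E) = (i != 3 :> nat)) ->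
       transferable R E).
  have /andP[c0 c3] := check_transfer4.
  split=> E DE.
  - exact (@check_transfer_sound R 4 128 0 E isT isT DE c0).
  - exact (@check_transfer_sound R 4 128 3 E isT isT DE c3).
case: aD => _ [[/leq_trans/(_ b5)]|[_ DE]]; first by rewrite ltnn.
subst b; case: DE => ->.
- apply: H0 => i; rewrite !inE.
  by case: i => -[|[|[|[|]]]].
- apply: H3 => i; rewrite !inE.
  by case: i => -[|[|[|[|]]]].
Qed.

(** * Computability of rho *)

Section RecursiveFunctions.
Local Open Scope nat_scope.

Lemma recursive_comp1 k (f : nat -> nat) (h : k.-tuple nat -> nat) :
  recursive (fun v : 1.-tuple nat => f (thead v)) -> recursive h ->
  recursive (fun v => f (h v)).
Proof.
move=> rf rh.
apply: recursive_ext (recursive_comp (h := fun=> h) rf (fun=> rh)) _ => v.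
by rewrite /thead tnth_mktuple.
Qed.

Lemma recursive_comp2 k (f : nat -> nat -> nat) (h1 h2 : k.-tuple nat -> nat) :
  recursive (fun v : 2.-tuple nat => f (tnth v ord0) (tnth v ord_max)) ->
  recursive h1 -> recursive h2 -> recursive (fun v => f (h1 v) (h2 v)).
Proof.
move=> rf r1 r2; pose h (i : 'I_2) := if i == ord0 then h1 else h2.
have rh i : recursive (h i) by rewrite /h; case: ifP.
by apply: recursive_ext (recursive_comp rf rh) _ => v; rewrite !tnth_mktuple.
Qed.

Lemma recursive_iter (f : nat -> nat -> nat) (g s : nat -> nat) :
  recursive (fun v : 1.-tuple nat => g (thead v)) ->
  recursive (fun v : 1.-tuple nat => s (thead v)) ->
  (forall y, f 0 y = g y) -> (forall n y, f n.+1 y = s (f n y)) ->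
  recursive (fun v : 2.-tuple nat => f (tnth v ord0) (tnth v ord_max)).
Proof.
move=> rg rs f0 fS.
(* The step function receives (n, previous value, y); position 1 is the previous value. *)
have rh : recursive (fun v : 3.-tuple nat => s (tnth v (inord 1))).
  exact: recursive_comp1 rs (recursive_proj _).
apply: (recursive_primrec rg rh) => [v|n v].
- by rewrite f0 /thead !(tnth_nth 0).
- by rewrite !(tnth_nth 0) /= inordK//= fS.
Qed.

Lemma recursive_addn :
  recursive (fun v : 2.-tuple nat => tnth v ord0 + tnth v ord_max).
Proof.
apply: (@recursive_iter addn id succn) => //; last exact: recursive_succ.
exact: recursive_proj.
Qed.

Lemma recursive_pred : recursive (fun v : 1.-tuple nat => (thead v).-1).
Proof.
apply: (recursive_primrec (recursive_zero 0)
  (recursive_proj (ord0 : 'I_2))) => [v|n v].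
- by rewrite /thead (tnth_nth 0).
- by rewrite /thead !(tnth_nth 0).
Qed.

Lemma recursive_subn :
  recursive (fun v : 2.-tuple nat => tnth v ord0 - tnth v ord_max).
Proof.
(* Recursion runs on the first coordinate, so y - n is built with n first and the arguments are
   swapped afterwards. *)
have r : recursive (fun v : 2.-tuple nat => tnth v ord_max - tnth v ord0).
  apply: (@recursive_iter (fun n y => y - n) id predn).
  - exact: recursive_proj.
  - exact: recursive_pred.
  - exact: subn0.
  - by move=> n y; rewrite subnS.
exact: (recursive_comp2 (f := fun a b => b - a) r (recursive_proj ord_max)
  (recursive_proj ord0)).
Qed.

Lemma recursive_const k c : recursive (fun _ : k.-tuple nat => c).
Proof.
elim: c => [|c IH]; first exact: recursive_zero.
exact: (recursive_comp1 recursive_succ IH).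
Qed.

Lemma recursive_expn2 : recursive (fun v : 1.-tuple nat => 2 ^ thead v).
Proof.
have rh : recursive (fun v : 2.-tuple nat => tnth v ord_max + tnth v ord_max).
  exact: recursive_comp2 recursive_addn (recursive_proj _) (recursive_proj _).
apply: (recursive_primrec (recursive_const 0 1) rh) => [v|n v].
- by rewrite /thead (tnth_nth 0).
- by rewrite /thead !(tnth_nth 0)/= expnS mul2n addnn.
Qed.

Lemma recursive_rho_approx : recursive (fun v : 3.-tuple nat =>
  2 ^ (tnth v ord_max - (tnth v ord0 + 12))).
Proof.
apply: recursive_comp1 recursive_expn2 _.
apply: recursive_comp2 recursive_subn (recursive_proj _) _.
apply: recursive_comp2 recursive_addn (recursive_proj _) _.
exact: recursive_const.
Qed.
End RecursiveFunctions.

(** For n >= b + 12 the approximation is exact. Below, truncated subtraction makes the numerator 1,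
    and both 2^-n and rho lie in [0, 2^-n]. *)
Lemma rho_computable (R : realType) :
  effectively_computable admissible (fun b _ => 2 ^- (b + 12) : R).
Proof.
exists (fun v => (2 ^ (tnth v ord_max - (tnth v ord0 + 12)))%N).
split; first exact: recursive_rho_approx.
move=> b D _ n; rewrite !(tnth_nth 0%N)/= natrX.
have p2 m : 2 ^+ m != 0 :> R by rewrite expf_neq0.
have [h|h] := leqP (b + 12) n.
  have -> : 2 ^+ n = 2 ^+ (n - (b + 12)) * 2 ^+ (b + 12) :> R.
    by rewrite -exprD subnK.
  rewrite invfM mulVKf// subrr normr0.
  by rewrite mulr_ge0// invr_ge0 exprn_ge0.
rewrite (eqP (ltnW h : n - _ == 0)%N) expr0 mul1r.
have : 2 ^- (b + 12) <= 2 ^- n :> R.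
  by rewrite lef_pV2 ?posrE ?exprn_gt0// ler_eXn2l ?ltr1n// ltnW.
have : 0 <= 2 ^- (b + 12) :> R by rewrite invr_ge0 exprn_ge0.
rewrite ler_norml; lra.
Qed.

(** * The divisor bound *)

Section DivisorBound.
Local Open Scope nat_scope.

Definition ndiv k := size (divisors k).

(** A divisor d of p^e m is p^i d' with p^i = gcd(d, p^e) and d' dividing m, which leaves e + 1
    choices of i and [ndiv m] choices of d'. *)
Lemma ndiv_pfactor p e m : prime p -> 0 < m ->
  ndiv (p ^ e * m) <= e.+1 * ndiv m.
Proof.
move=> pp m0; have k0 : 0 < p ^ e * m by rewrite muln_gt0 expn_gt0 prime_gt0.
pose s := [seq p ^ i * d | i <- iota 0 e.+1, d <- divisors m].
have -> : e.+1 * ndiv m = size s by rewrite size_allpairs size_iota.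
apply: uniq_leq_size; first exact: divisors_uniq.
move=> d; rewrite -dvdn_divisors// => dk.
have /dvdn_pfactor : gcdn d (p ^ e) %| p ^ e by exact: dvdn_gcdr.
move=> /(_ pp)[i ie gE].
have /dvdnP[d' dE] : p ^ i %| d by rewrite -gE dvdn_gcdl.
apply/allpairsP; exists (i, d'); split.
- by rewrite mem_iota.
- rewrite -dvdn_divisors// -(@dvdn_pmul2l (p ^ i)) ?expn_gt0 ?prime_gt0//.
  by rewrite mulnC -dE -gE muln_gcdl dvdn_gcd dvdn_mulr// dk.
- by rewrite mulnC.
Qed.

(** From e + 1 <= r (f + 1) <= r 2^f, where f is the integer part of e/r, raised to the power r. *)
Lemma expn_succ_le r e : 0 < r -> e.+1 ^ r <= r ^ r * 2 ^ e.
Proof.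
move=> r0; have h : e.+1 <= r * 2 ^ (e %/ r).
  apply: leq_trans (_ : r * (e %/ r).+1 <= _).
    by rewrite mulnC ltn_ceil.
  by rewrite leq_mul2l ltn_expl ?orbT.
apply: leq_trans (_ : (r * 2 ^ (e %/ r)) ^ r <= _); first by rewrite leq_exp2r.
by rewrite expnMn -expnM leq_mul2l leq_exp2l// leq_trunc_div orbT.
Qed.

(** Induction on the bound B for the prime factors. A prime power p^e contributes at most (e+1)^r,
    which is at most r^r p^e in general and at most p^e once p >= 2^r. Only primes below 2^r cost a
    factor r^r, whence the exponent [minn B (2 ^ r)]. *)
Lemma ndiv_smooth r B k : 0 < r -> 0 < k ->
  (forall p, prime p -> p %| k -> p < B) ->
  ndiv k ^ r <= (r ^ r) ^ minn B (2 ^ r) * k.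
Proof.
move=> r0; have c0 : 0 < r ^ r by rewrite expn_gt0 r0.
elim: B k => [|B IH] k k0 kB.
  have -> : k = 1.
    apply/eqP; rewrite eqn_leq k0 andbT leqNgt; apply/negP => k1.
    by have := kB _ (pdiv_prime k1) (pdiv_dvd k).
  by rewrite /ndiv (_ : divisors 1 = [:: 1])//= exp1n muln1 expn_gt0 c0.
have mono : (r ^ r) ^ minn B (2 ^ r) <= (r ^ r) ^ minn B.+1 (2 ^ r).
  by rewrite leq_pexp2l// leq_min geq_minr andbT (leq_trans (geq_minl _ _)).
have [pB|pB] := boolP (prime B); last first.
  apply: leq_trans (IH k k0 _) _; last by rewrite leq_mul2r mono orbT.
  move=> p pp pk; have := kB p pp pk; rewrite ltnS leq_eqVlt => /orP[/eqP E|//].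
  by rewrite -E pp in pB.
have [m cm kE] := pfactor_coprime pB k0; set e := logn B k in kE.
have m0 : 0 < m by move: k0; rewrite kE muln_gt0 => /andP[].
have mB p : prime p -> p %| m -> p < B.
  move=> pp pm; have := kB p pp; rewrite kE dvdn_mulr// => /(_ isT).
  rewrite ltnS leq_eqVlt => /orP[/eqP E|//].
  by move: cm; rewrite -E prime_coprime// pm.
rewrite kE mulnC; apply: leq_trans (_ : (e.+1 * ndiv m) ^ r <= _).
  by rewrite leq_exp2r// ndiv_pfactor.
rewrite expnMn; have IHm := IH m m0 mB.
have [Bs|Bl] := ltnP B (2 ^ r).
  have -> : minn B.+1 (2 ^ r) = B.+1 by apply/minn_idPl.
  rewrite (minn_idPl (ltnW Bs)) in IHm.
  rewrite expnS mulnCA mulnA [r ^ r * _]mulnC -mulnA.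
  rewrite [B ^ e * _]mulnCA [_ * (B ^ e * m)]mulnCA mulnA.
  rewrite [X in _ <= X](_ : _ = (r ^ r * B ^ e) * ((r ^ r) ^ B * m)); last by lia.
  apply: leq_mul => //; apply: leq_trans (expn_succ_le e r0) _.
  rewrite leq_mul2l; apply/orP; right; case: (e) => // n.
  by rewrite leq_exp2r// prime_gt1.
rewrite [X in _ <= X](_ : _ = B ^ e * ((r ^ r) ^ minn B.+1 (2 ^ r) * m)); last by lia.
apply: leq_mul.
  apply: leq_trans (_ : (2 ^ e) ^ r <= _); first by rewrite leq_exp2r// ltn_expl.
  by rewrite -expnM mulnC expnM; case: (e) => // n; rewrite leq_exp2r.
by apply: leq_trans IHm _; rewrite leq_mul2r mono orbT.
Qed.

(** The classical d(k) = O(k^(1/r)), raised to the power r to stay in the integers. *)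
Lemma ndiv_bound r : 0 < r -> exists2 C, 0 < C &
  forall k, 0 < k -> ndiv k ^ r <= C * k.
Proof.
move=> r0; have c0 : 0 < r ^ r by rewrite expn_gt0 r0.
exists ((r ^ r) ^ 2 ^ r); first by rewrite expn_gt0 c0.
move=> k k0; apply: leq_trans (@ndiv_smooth r k.+1 k r0 k0 _) _.
  by move=> p _ /dvdn_leq; rewrite ltnS; apply.
by rewrite leq_mul2r leq_pexp2l ?geq_minr// orbT.
Qed.
End DivisorBound.

(** * Counting rationals with a Fejer kernel *)

Section Counting.
Context {R : realType}.

Definition digits_val (b n : nat) (v : {ffun 'I_n -> 'I_b}) : nat :=
  (\sum_(i < n) v i * b ^ (n - i.+1))%N.

Lemma digits_val_div (b n : nat) (v : {ffun 'I_n -> 'I_b}) : (0 < b)%N ->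
  (digits_val v)%:R / b%:R ^+ n = \sum_(i < n) (v i)%:R / b%:R ^+ i.+1 :> R.
Proof.
move=> b0; have bR : b%:R != 0 :> R by rewrite pnatr_eq0 -lt0n.
rewrite /digits_val natr_sum mulr_suml; apply: eq_bigr => i _.
rewrite natrM natrX -mulrA; congr (_ * _).
rewrite -[X in _ / _ ^+ X](subnK (ltn_ord i)) exprD invfM mulrA divff ?mul1r//.
by rewrite expf_neq0.
Qed.

Section FixedBase.
Variables (b n : nat) (D : {set 'I_b}).
Hypothesis b0 : (0 < b)%N.

(** This is |D|^n times the modulus of the Fourier coefficient at k of the uniform measure on the
    n-digit points. *)
Definition phi_prod (k : nat) : R :=
  \prod_(i < n) normc (phi D (k%:R / b%:R ^+ i.+1) : R[i]).

Lemma phi_prod_ge0 k : 0 <= phi_prod k.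
Proof. by apply: prodr_ge0 => i _; exact: normc_ge0. Qed.

Lemma Re_sum (I : Type) (r : seq I) (P : pred I) (F : I -> R[i]) :
  complex.Re (\sum_(i <- r | P i) F i) = \sum_(i <- r | P i) complex.Re (F i).
Proof. by apply: (big_morph (@complex.Re R)) => // -[? ?] [? ?]. Qed.

Lemma sum_ex_digits_val_le k :
  \sum_(v : {ffun 'I_n -> 'I_b} | v \in ffun_on (mem D))
     complex.Re (ex (k%:R * ((digits_val v)%:R / b%:R ^+ n)) : R[i])
    <= phi_prod k.
Proof.
rewrite -Re_sum; apply: le_trans (Re_le_normc _) _.
rewrite /phi_prod -normc_prod /phi (bigA_distr_big (mem D)).
rewrite le_eqVlt; apply/orP; left; apply/eqP; congr normc.
apply: eq_bigr => v _; rewrite digits_val_div// mulr_sumr ex_sum.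
by apply: eq_bigr => i _; rewrite mulrCA.
Qed.

Lemma sum_nat_of_bool (T : Type) (r : seq T) (a : pred T) :
  (\sum_(x <- r) a x)%N = count a r.
Proof. by rewrite -sum1_count [RHS]big_mkcond; apply: eq_bigr => x _; case: (a x). Qed.

(** A pair (l, q) with k = l q is determined by l, a divisor of k. *)
Lemma sum_eq_mul_le (H Q k : nat) : (0 < k)%N ->
  (\sum_(1 <= l < H) \sum_(1 <= q < Q) (k == l * q) <= ndiv k)%N.
Proof.
move=> k0; apply: (@leq_trans (\sum_(1 <= l < H) (l %| k))%N).
  rewrite big_nat_cond [X in (_ <= X)%N]big_nat_cond.
  apply: leq_sum => l /andP[/andP[l0 _] _].
  have [lk|lk] := boolP (l %| k)%N; last first.
    rewrite big1// => q _; apply/eqP; rewrite eqb0; apply: contra lk => /eqP ->.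
    exact: dvdn_mulr.
  apply: (@leq_trans (\sum_(q <- index_iota 1 Q) (q == k %/ l))%N).
    by apply: leq_sum => q _; case: eqP => // ->; rewrite mulKn// eqxx.
  by rewrite sum_nat_of_bool count_uniq_mem ?iota_uniq// leq_b1.
rewrite sum_nat_of_bool -size_filter; apply: uniq_leq_size.
  by rewrite filter_uniq// iota_uniq.
by move=> l; rewrite mem_filter -dvdn_divisors// => /andP[].
Qed.

(** Terms are grouped by the value of [g]. It serves twice: for products l q, with fibres bounded by
    the divisor count, and for distances |h - h'|, with fibres of size at most 2. *)
Lemma sum_fiber_le (I : eqType) (r : seq I) (P : pred I) (g : I -> nat)
    (f : nat -> R) (c : R) m M : (forall k, 0 <= f k) ->
  (forall i, i \in r -> P i -> (m <= g i < M)%N) ->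
  (forall k, (m <= k < M)%N -> (\sum_(i <- r | P i) (k == g i))%N%:R <= c) ->
  \sum_(i <- r | P i) f (g i) <= c * \sum_(m <= k < M) f k.
Proof.
move=> f0 gP cP.
have -> : \sum_(i <- r | P i) f (g i)
   = \sum_(i <- r | P i) \sum_(m <= k < M) (k == g i)%:R * f k.
  rewrite big_seq_cond [RHS]big_seq_cond; apply: eq_bigr => i /andP[ir Pi].
  rewrite (bigD1_seq (g i)) ?iota_uniq ?mem_index_iota ?gP//= eqxx mul1r.
  by rewrite big1 ?addr0// => k /negPf ->; rewrite mul0r.
rewrite exchange_big/= mulr_sumr big_nat_cond [leRHS]big_nat_cond.
apply: ler_sum => k /andP[kM _]; rewrite -mulr_suml -natr_sum.
by rewrite ler_wpM2r// cP.
Qed.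

Lemma sum_phi_prod_mul_le (H Q M : nat) (Dm : R) :
  (forall k, (0 < k < M)%N -> (ndiv k)%:R <= Dm) -> (H * Q <= M)%N ->
  \sum_(1 <= l < H) \sum_(1 <= q < Q) phi_prod (l * q)
    <= Dm * \sum_(1 <= k < M) phi_prod k.
Proof.
move=> hD HQ.
have -> : \sum_(1 <= l < H) \sum_(1 <= q < Q) phi_prod (l * q)
  = \sum_(p <- [seq (l, q) | l <- index_iota 1 H, q <- index_iota 1 Q])
      phi_prod (p.1 * p.2) by rewrite big_allpairs.
apply: (@sum_fiber_le _ _ xpredT (fun p => p.1 * p.2)%N) => [|[l q] h _|k kM].
- exact: phi_prod_ge0.
- move: h => /allpairsP[[l' q'] /=]; rewrite !mem_index_iota.
  move=> [/andP[l0 lH] /andP[q0 qQ] [-> ->]].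
  rewrite muln_gt0 l0 q0/= (leq_trans _ HQ)//; exact: ltn_mul.
- apply: le_trans (hD k kM); rewrite big_allpairs/= ler_nat.
  by apply: sum_eq_mul_le; case/andP: kM.
Qed.

Lemma sum_abs_diff_le (H h : nat) (f : nat -> R) : (forall l, 0 <= f l) ->
  (h < H)%N ->
  \sum_(h' < H | h' != h :> nat) f `|h%:Z - h'%:Z|%N <= 2 * \sum_(1 <= l < H) f l.
Proof.
move=> f0 hH.
rewrite -(big_mkord (fun h' => h' != h) (fun h' => f `|h%:Z - h'%:Z|%N)).
apply: (@sum_fiber_le _ _ _ (fun h' => `|h%:Z - h'%:Z|%N)) => // [i|k _].
  by rewrite mem_index_iota => /andP[_ iH] /eqP ih; lia.
rewrite (ler_nat _ _ 2) big_mkcond/=.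
apply: (@leq_trans (\sum_(0 <= i < H) ((i == h + k) + (i == h - k)))%N).
  apply: leq_sum => i _; case: ifP => // _.
  have [->|] := eqVneq k; last by [].
  have [hi|hi] := leqP h i.
    by rewrite (_ : (i == _) = true)//; apply/eqP; lia.
  by rewrite (_ : (i == h - _)%N = true) ?addn1//; apply/eqP; lia.
rewrite big_split/= !sum_nat_of_bool !count_uniq_mem ?iota_uniq//.
by case: (_ \in _); case: (_ \in _).
Qed.

(** With all H digits allowed, [phi] is the Dirichlet kernel, whose squared modulus is H times the
    Fejer kernel. Here q a / M falls short of the integer p by s <= q / M, so h s <= 1/16, every
    phase is at most 2/5 and every cosine exceeds 1/2. *)
Lemma fejer_lower_bound (H q a p M : nat) : (0 < M)%N -> (16 * H * q <= M)%N ->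
  (a * q <= p * M <= a.+1 * q)%N ->
  H%:R / 2 <= normc (phi [set: 'I_H]%SET (q%:R * (a%:R / M%:R)) : R[i]).
Proof.
move=> M0 HM /andP[pl pu]; apply: le_trans (Re_le_normc _).
rewrite /phi Re_sum.
have -> : H%:R / 2 = \sum_(h in [set: 'I_H]%SET) (1 / 2 : R).
  by rewrite sumr_const cardsT card_ord -[RHS]mulr_natl mul1r.
have MR : 0 < M%:R :> R by rewrite ltr0n.
apply: ler_sum => h _.
pose s : R := (p * M - a * q)%:R / M%:R.
have -> : ex (h%:R * (q%:R * (a%:R / M%:R))) = ex (- (h%:R * s)) :> R[i].
  rewrite -[RHS](exDnat _ (h * p)); congr ex.
  by rewrite /s natrB// !natrM; field; rewrite gt_eqF.
rewrite Re_ex mulrN cosN.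
have hs0 : 0 <= h%:R * s by rewrite mulr_ge0// divr_ge0.
have hs : h%:R * s <= 1 / 16.
  rewrite mulrA ler_pdivrMr// -natrM -ler_pdivrMl// invf_div divr1 -natrM ler_nat.
  apply: leq_trans HM; rewrite -mulnA leq_mul2l/= leq_mul//.
    exact: ltnW.
  by rewrite leq_subLR -mulSnr.
move: (h%:R * s) hs0 hs => y y0 y1; apply: le_trans (cos_ge_sqr _).
have p0 := pi_gt0 R; have p1 := @pi_lt_16_5 R.
have : 2 * pi * y <= 2 / 5 by nra.
have : 0 <= 2 * pi * y by rewrite !mulr_ge0// ltW.
move: (2 * pi * y) => z; nra.
Qed.

Lemma sqr_normc_phiT (H : nat) (t : R) :
  normc (phi [set: 'I_H]%SET t) ^+ 2 =
  \sum_(h < H) \sum_(h' < H) complex.Re (ex ((h%:R - h'%:R) * t)).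
Proof.
rewrite sqr_normc_phi (eq_bigl xpredT) => [|h]; last by rewrite finset.in_setT.
apply: eq_bigr => h _; rewrite (eq_bigl xpredT)// => h'; by rewrite finset.in_setT.
Qed.

(** At a hit the squared Dirichlet kernel is at least H^2/4, so hits are counted by 4/H^2 times its
    sum, expanded over pairs (h, h'). The H diagonal pairs give the term in Q |D|^n. Off the
    diagonal, for fixed h each l = |h - h'| occurs at most twice, and each k = l q < b^n arises at
    most [Dm] times, which leaves the l^1 sum. *)
Lemma count_bound (H Q : nat) (Dm S : R)
    (A : {ffun 'I_n -> 'I_b} -> nat -> bool) :
  (0 < H)%N -> (16 * H * Q <= b ^ n)%N ->
  (forall k, (0 < k < b ^ n)%N -> (ndiv k)%:R <= Dm) -> 0 <= Dm ->
  \sum_(k < b ^ n) phi_prod k <= S ->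
  (forall v q, (1 <= q < Q)%N -> A v q -> exists p : nat,
     (digits_val v * q <= p * b ^ n <= (digits_val v).+1 * q)%N) ->
  \sum_(1 <= q < Q) \sum_(v : {ffun 'I_n -> 'I_b} | v \in ffun_on (mem D)) (A v q)%:R
    <= 4 * Q%:R * #|D|%:R ^+ n / H%:R + 8 * Dm * S / H%:R.
Proof.
move=> H0 HM hD Dm0 hS hA.
have M0 : (0 < b ^ n)%N by rewrite expn_gt0 b0.
have HR : 0 < H%:R :> R by rewrite ltr0n.
pose G (k : nat) := \sum_(v : {ffun 'I_n -> 'I_b} | v \in ffun_on (mem D))
     complex.Re (ex (k%:R * ((digits_val v)%:R / b%:R ^+ n)) : R[i]).
have G0 : G 0%N = #|D|%:R ^+ n.
  rewrite /G (eq_bigr (fun=> 1)) => [|v _]; last by rewrite mul0r ex0.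
  by rewrite sumr_const card_ffun_on card_ord natrX.
have fejer : \sum_(1 <= q < Q) \sum_(v : {ffun 'I_n -> 'I_b} | v \in ffun_on (mem D))
     (A v q)%:R <= \sum_(1 <= q < Q) 4 / H%:R ^+ 2 *
        \sum_(h < H) \sum_(h' < H) G (`|h%:Z - h'%:Z| * q)%N.
  rewrite big_nat_cond [leRHS]big_nat_cond; apply: ler_sum => q /andP[qQ _].
  have -> : \sum_(h < H) \sum_(h' < H) G (`|h%:Z - h'%:Z| * q)%N
     = \sum_(v : {ffun 'I_n -> 'I_b} | v \in ffun_on (mem D))
         normc (phi [set: 'I_H]%SET (q%:R * ((digits_val v)%:R / b%:R ^+ n)) : R[i]) ^+ 2.
    under [RHS]eq_bigr do rewrite sqr_normc_phiT.
    rewrite [RHS]exchange_big; apply: eq_bigr => h _.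
    rewrite [RHS]exchange_big; apply: eq_bigr => h' _.
    apply: eq_bigr => v _.
    (* The real part of [ex] is even, so only |h - h'| matters and frequencies stay natural
       numbers. *)
    have [hh|hh] := leqP h' h.
      have -> : `|h%:Z - h'%:Z|%N = (h - h')%N by lia.
      by rewrite natrM natrB// -mulrA.
    have -> : `|h%:Z - h'%:Z|%N = (h' - h)%N by lia.
    rewrite natrM natrB ?(ltnW hh)// -mulrA -opprB mulNr !Re_ex mulrN cosN//.
  rewrite mulr_sumr; apply: ler_sum => v _.
  have [Av|_] := boolP (A v q); last by rewrite mulr_ge0 ?sqr_ge0// divr_ge0.
  have [p hp] := hA v q qQ Av.
  have HqM : (16 * H * q <= b ^ n)%N.
    by apply: leq_trans HM; rewrite leq_mul2l ltnW ?orbT//; case/andP: qQ.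
  have := fejer_lower_bound M0 HqM hp; rewrite natrX.
  set z := normc _ => hz.
  rewrite mulrAC ler_pdivlMr ?exprn_gt0// mul1r; nra.
apply: (le_trans fejer); rewrite -mulr_sumr.
rewrite exchange_big/=.
apply: le_trans (_ : 4 / H%:R ^+ 2 * \sum_(h < H)
    (Q%:R * #|D|%:R ^+ n + 2 * (Dm * S)) <= _); last first.
  rewrite sumr_const card_ord -[X in _ * X <= _]mulr_natl le_eqVlt; apply/orP; left; apply/eqP.
  by field; rewrite gt_eqF.
rewrite ler_wpM2l ?divr_ge0// ?sqr_ge0//; apply: ler_sum => h _.
rewrite exchange_big/= (bigD1 h)//= subrr.
apply: lerD.
  rewrite (eq_bigr (fun=> #|D|%:R ^+ n)) => [|q _]; last by rewrite mul0n G0.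
  rewrite sumr_const_nat -[leLHS]mulr_natl ler_wpM2r ?exprn_ge0// ler_nat.
  exact: leq_subr.
apply: le_trans (_ : \sum_(h' < H | h' != h :> nat)
   \sum_(1 <= q < Q) phi_prod (`|h%:Z - h'%:Z| * q)%N <= _).
  apply: ler_sum => h' _; apply: ler_sum => q _; exact: sum_ex_digits_val_le.
apply: le_trans (sum_abs_diff_le (f := fun l => \sum_(1 <= q < Q) phi_prod (l * q))
  _ (ltn_ord h)) _.
  by move=> l; apply: sumr_ge0 => q _; exact: phi_prod_ge0.
rewrite ler_pM2l//; apply: le_trans (sum_phi_prod_mul_le hD _) _.
  by apply: leq_trans HM; rewrite -mulnA leq_pmull.
rewrite ler_wpM2l//; apply: le_trans hS.
rewrite -(big_mkord xpredT) [leRHS](@big_cat_nat _ _ _ 1)//=.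
by rewrite lerDr big_nat1 phi_prod_ge0.
Qed.
End FixedBase.
End Counting.

(** * Digit expansions and their truncations *)

Section DigitSeries.
Context {R : realType}.

Lemma digit_tail_le (b m k : nat) : (1 < b)%N ->
  \sum_(m <= i < m + k) (b%:R - 1) / b%:R ^+ i.+1 <= b%:R ^- m :> R.
Proof.
move=> b1; have bR : b%:R != 0 :> R by rewrite pnatr_eq0 -lt0n ltnW.
have -> : \sum_(m <= i < m + k) (b%:R - 1) / b%:R ^+ i.+1
   = b%:R ^- m - b%:R ^- (m + k) :> R.
  elim: k => [|k IH]; first by rewrite addn0 big_geq// subrr.
  rewrite addnS big_nat_recr ?leq_addr//= IH exprS.
  by field; rewrite bR !expf_neq0.
by rewrite lerBlDr lerDl invr_ge0 exprn_ge0.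
Qed.

(** Both ends are closed, since the tail may vanish or consist of digits b - 1 only; this is why
    hits are counted with non-strict inequalities. *)
Lemma digit_series_bounds (b n : nat) (d : nat -> 'I_b) (y : R) : (1 < b)%N ->
  series (fun i => (d i)%:R / b%:R ^+ i.+1 : R) @ \oo --> y ->
  let a := (digits_val [ffun i : 'I_n => d i])%:R : R in
  a / b%:R ^+ n <= y <= a / b%:R ^+ n + b%:R ^- n.
Proof.
move=> b1 dy /=; have b0 : (0 < b)%N by exact: ltnW.
have t0 i : 0 <= (d i)%:R / b%:R ^+ i.+1 :> R by rewrite divr_ge0 ?exprn_ge0.
rewrite digits_val_div//.
have -> : \sum_(i < n) ([ffun i : 'I_n => d i] i)%:R / b%:R ^+ i.+1
   = series (fun i => (d i)%:R / b%:R ^+ i.+1 : R) n.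
  rewrite seriesEord/=; apply: eq_bigr => i _; by rewrite ffunE.
have cv : cvg (series (fun i => (d i)%:R / b%:R ^+ i.+1 : R) @ \oo).
  by apply/cvg_ex; exists y.
have <- := cvg_lim (@Rhausdorff R) dy.
apply/andP; split.
- apply: limr_ge => //; near=> k.
  have nk : (n <= k)%N by near: k; exact: nbhs_infty_ge.
  rewrite !seriesEnat/= [leRHS](@big_cat_nat _ _ _ n)//= lerDl.
  by apply: sumr_ge0.
- apply: limr_le => //; near=> k.
  have nk : (n <= k)%N by near: k; exact: nbhs_infty_ge.
  rewrite !seriesEnat/= [leLHS](@big_cat_nat _ _ _ n)//= lerD2l.
  apply: le_trans (@digit_tail_le b n (k - n) b1); rewrite subnKC//.
  apply: ler_sum => i _; rewrite ler_wpM2r ?invr_ge0 ?exprn_ge0//.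
  by have := ltn_ord (d i); rewrite -(ler_nat R) -natr1; lra.
Unshelve. all: by end_near. Qed.

Lemma digits_sum_inj (b m : nat) (f g : nat -> nat) :
  (forall i, f i < b)%N -> (forall i, g i < b)%N ->
  (\sum_(i < m) f i * b ^ (m - i.+1) = \sum_(i < m) g i * b ^ (m - i.+1))%N ->
  forall i, (i < m)%N -> f i = g i.
Proof.
move=> fb gb; have b0 : (0 < b)%N by exact: leq_ltn_trans (fb 0%N).
have rec (h : nat -> nat) k : (\sum_(i < k.+1) h i * b ^ (k.+1 - i.+1)
    = (\sum_(i < k) h i * b ^ (k - i.+1)) * b + h k)%N.
  rewrite big_ord_recr/= subnn muln1; congr (_ + _)%N.
  rewrite big_distrl/=; apply: eq_bigr => i _.
  by rewrite subSn// expnSr mulnA.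
elim: m => [//|m IH]; rewrite !rec => E i.
have E1 : f m = g m.
  by have := congr1 (modn^~ b) E; rewrite !modnMDl !modn_small.
rewrite ltnS leq_eqVlt => /orP[/eqP ->//|]; apply: IH.
by move: E; rewrite E1 => /addIn/eqP; rewrite eqn_pmul2r// => /eqP.
Qed.

Lemma digits_val_inj (b m : nat) : injective (@digits_val b m).
Proof.
move=> v w; case: b => [|b] in v w *.
  move=> _; apply/ffunP => i; by case: (v i).
move=> E; apply/ffunP => i.
pose F (u : {ffun 'I_m -> 'I_b.+1}) (j : nat) : nat :=
  if insub j is Some k then u k else 0%N.
have Fb u j : (F u j < b.+1)%N by rewrite /F; case: insub.
have FE u (j : 'I_m) : F u j = u j by rewrite /F valK.
apply/val_inj; rewrite /= -!FE.
apply: (@digits_sum_inj b.+1 m) => //.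
by under eq_bigr do rewrite FE; under [RHS]eq_bigr do rewrite FE.
Qed.
End DigitSeries.

(** * The natural measure of small balls *)

Lemma measure_bigsetU_le d (T : measurableType d) (R : realType)
    (mu : {measure set T -> \bar R}) (I : Type) (s : seq I) (P : pred I)
    (F : I -> set T) : (forall i, P i -> measurable (F i)) ->
  (mu (\big[setU/set0]_(i <- s | P i) F i) <= \sum_(i <- s | P i) mu (F i))%E.
Proof.
move=> mF; elim: s => [|i s IH]; first by rewrite !big_nil measure0.
rewrite !big_cons; case: ifP => // Pi.
set B := (X in F i `|` X).
have mB : measurable B by apply: bigsetU_measurable => j; exact: mF.
have h : (mu (F i `|` B) <= mu (F i) + mu B)%E by apply: measureU2 => //; exact: mF.
exact: le_trans h (leeD2l _ IH).
Qed.

Section NaturalMeasure.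
Context {R : realType} (b : nat) (D : {set 'I_b}).
Hypotheses (b1 : (1 < b)%N) (D0 : (0 < #|D|)%N).

(** The |D| digit values give disjoint events of mass 1/|D|, which exhaust the total mass. *)
Lemma uniform_support d (T : measurableType d) (P : probability T R)
    (X : {RV P >-> R}) : uniform_on_digits D X ->
  P.-negligible (~` [set t | exists2 a : 'I_b, a \in D & X t = a%:R]).
Proof.
move=> uX; set G := [set t | _].
pose U (s : seq 'I_b) := \big[setU/set0]_(a <- s) (X @^-1` [set a%:R : R]).
have mX (a : 'I_b) : measurable (X @^-1` [set a%:R : R]).
  by rewrite -[X in measurable X]setTI; exact: measurable_funPT.
have mU s : measurable (U s) by apply: bigsetU_measurable.
have PU s : uniq s -> {subset s <= D} -> P (U s) = ((size s)%:R / #|D|%:R)%:E.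
  elim: s => [|a s IH] /=; first by rewrite /U big_nil measure0 mul0r.
  move=> /andP[as_ us] sD.
  have -> : U (a :: s) = X @^-1` [set a%:R : R] `|` U s by rewrite /U big_cons.
  have PE : P (X @^-1` [set a%:R : R] `|` U s)
      = (P (X @^-1` [set a%:R : R]) + P (U s))%E.
    apply: measureU => //; rewrite -subset0 => t [] /= Xa.
    rewrite /U -bigcup_seq => -[c /= cs Xc]; move: Xa; rewrite Xc => /eqP; rewrite eqr_nat => /eqP/val_inj ca.
    by rewrite -ca cs in as_.
  rewrite PE IH// => [|x xs]; last by rewrite sD// inE xs orbT.
  rewrite uX ?sD ?mem_head//.
  by rewrite -EFinD -natr1 mulrDl mul1r addrC.
have PD : P (U (enum D)) = 1%E.
  rewrite PU ?enum_uniq//; last by move=> a; rewrite mem_enum.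
  by rewrite -cardE divff// pnatr_eq0 -lt0n.
exists (~` U (enum D)); split.
- exact: measurableC.
- by rewrite probability_setC// PD subee.
- apply: subsetC => t; rewrite /U -bigcup_seq => -[a /=]; rewrite mem_enum => aD Xa.
  by exists a.
Qed.

Lemma cylinder_measure d (T : measurableType d) (P : probability T R)
    (X : nat -> {RV P >-> R}) m (v : {ffun 'I_m -> 'I_b}) :
  mutually_independent X -> (forall i, uniform_on_digits D (X i)) ->
  v \in ffun_on (mem D) ->
  measurable [set t | forall i : 'I_m, X i t = (v i)%:R] /\
  P [set t | forall i : 'I_m, X i t = (v i)%:R] = (#|D|%:R ^- m)%:E.
Proof.
move=> indX uX /ffun_onP vD.
(* Independence is stated for sets indexed by all naturals; indices from m on get the whole line. *)
pose B (j : nat) : set R := if insub j is Some i then [set (v i)%:R] else setT.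
have mB j : measurable (B j) by rewrite /B; case: insub => // i; exact: measurable_set1.
have -> : [set t | forall i : 'I_m, X i t = (v i)%:R]
   = \big[setI/setT]_(j <- iota 0 m) (X j @^-1` B j).
  rewrite -bigcap_seq; apply/seteqP; split => [t h j /=|t h i].
    by rewrite mem_iota add0n /B => /= jm; rewrite insubT /=; exact: (h (Ordinal jm)).
  by have := h i; rewrite /= mem_iota/= add0n ltn_ord /B valK; apply.
split.
  apply: bigsetI_measurable => j _.
  by rewrite -[X in measurable X]setTI; exact: measurable_funPT.
rewrite indX ?iota_uniq//.
transitivity (\prod_(j <- iota 0 m) (#|D|%:R^-1 : R)%:E)%E.
  rewrite big_seq [RHS]big_seq; apply: eq_bigr => j.
  rewrite mem_iota add0n /= => jm; rewrite /B insubT/=.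
  by rewrite uX//; exact: vD.
by rewrite prodEFin big_const_seq count_predT size_iota iter_mulr_1 exprVn.
Qed.

(** If a point of the ball has m-digit truncation v, then [digits_val v] is within 2 of c b^m: 1
    from the radius and 1 from the tail. At most 4 integers qualify, and each cylinder has mass
    |D|^-m. *)
Lemma ball_measure (nu : probability R R) (m : nat) (c : R) :
  natural_measure D nu ->
  (nu [set x : R | (`|x - c| < b%:R ^- m)%R] <= (4 / #|D|%:R ^+ m)%:E)%E.
Proof.
move=> [d [T [P [X [S [indX uX cvS nuE]]]]]].
have b0 : (0 < b)%N by exact: ltnW.
have bm : 0 < b%:R ^+ m :> R by rewrite exprn_gt0// ltr0n.
have mA : measurable [set x : R | `|x - c| < b%:R ^- m].
  rewrite (_ : [set x | _] = ball c (b%:R ^- m)); last first.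
    by apply/seteqP; split => x; rewrite /ball/= distrC.
  exact: measurable_realfun.measurable_ball.
rewrite nuE// /distribution /pushforward.
(* Outside one null set the series converges to S and every X i is a digit of D, so pathwise
   expansions are available. *)
have /negligibleU/(_ (negligible_bigcup (fun i => uniform_support (uX i)))) := cvS.
move=> [N [mN PN0 subN]].
pose Vc := [pred v : {ffun 'I_m -> 'I_b} | (v \in ffun_on (mem D)) &&
   (`|(digits_val v)%:R - c * b%:R ^+ m| < 2)].
pose C (v : {ffun 'I_m -> 'I_b}) := [set t | forall i : 'I_m, X i t = (v i)%:R].
have cylV v : Vc v -> measurable (C v) /\ P (C v) = (#|D|%:R ^- m)%:E.
  by move=> /andP[vD _]; exact: cylinder_measure.
have card4 : (#|Vc| <= 4)%N.
  pose z : int := Num.floor (c * b%:R ^+ m).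
  have := @leq_card_in _ 'I_4
    (fun v : {ffun 'I_m -> 'I_b} => inord (absz ((digits_val v)%:Z - z + 1)%R)) Vc.
  rewrite card_ord; apply => v w; rewrite !inE => /andP[_ hv] /andP[_ hw].
  have dz (u : {ffun 'I_m -> 'I_b}) : `|(digits_val u)%:R - c * b%:R ^+ m| < 2 ->
      0 <= (digits_val u)%:Z - z + 1 < 4.
    have := floor_itv (c * b%:R ^+ m : R); rewrite -/z intrD => /andP[z1 z2].
    rewrite ltr_norml => /andP[h1 h2].
    have h3 : (z%:~R : R) < (digits_val u)%:Z%:~R + 2%:~R.
      by rewrite -pmulrn; lra.
    have h4 : (digits_val u)%:Z%:~R < (z%:~R : R) + 3%:~R.
      by rewrite -pmulrn; lra.
    move: h3 h4; rewrite -!intrD !ltr_int; lia.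
  have := dz v hv; have := dz w hw => w4 v4 /(congr1 val).
  rewrite /= !inordK; [|lia..].
  by move=> E; apply: digits_val_inj; lia.
have sub : S @^-1` [set x | `|x - c| < b%:R ^- m]
    `<=` N `|` \big[setU/set0]_(v : {ffun 'I_m -> 'I_b} | Vc v) C v.
  move=> t /= St; have [Nt|Nt] := pselect (N t); [by left|right].
  have good : ~ (~` [set x | series (fun i => X i x / b%:R ^+ i.+1) @ \oo --> S x]
     `|` \bigcup_k ~` [set t0 | exists2 a : 'I_b, a \in D & X k t0 = a%:R]) t.
    by move=> h; apply: Nt; exact: subN.
  have cv : series (fun i => X i t / b%:R ^+ i.+1) @ \oo --> S t.
    by apply: contrapT => h; apply: good; left.
  have /choice[dg dgP] : forall i, exists a : 'I_b, a \in D /\ X i t = a%:R.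
    move=> i; have [[a aD Xa]|h] := pselect (exists2 a : 'I_b, a \in D & X i t = a%:R).
      by exists a.
    by exfalso; apply: good; right; exists i.
  pose v := [ffun i : 'I_m => dg i].
  have cv' : series (fun i => (dg i)%:R / b%:R ^+ i.+1 : R) @ \oo --> S t.
    rewrite (_ : (fun i => _) = (fun i => X i t / b%:R ^+ i.+1))//.
    by apply/funext => i; have [_ ->] := dgP i.
  have /andP[s1 s2] := digit_series_bounds m b1 cv'; rewrite -/v in s1 s2.
  rewrite -bigcup_seq_cond; exists v; last first.
    by move=> i; have [_ ->] := dgP i; rewrite ffunE.
  rewrite /= mem_index_enum/=; apply/andP; split.
    by apply/ffun_onP => i; rewrite ffunE; have [] := dgP i.
  have s1' : (digits_val v)%:R <= S t * b%:R ^+ m by rewrite -ler_pdivrMr.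
  have s2' : S t * b%:R ^+ m <= (digits_val v)%:R + 1.
    by rewrite -ler_pdivlMr// mulrDl mul1r.
  have : `|S t * b%:R ^+ m - c * b%:R ^+ m| < 1.
    by rewrite -mulrBl normrM (gtr0_norm bm) -ltr_pdivlMr// div1r.
  by rewrite !ltr_norml; lra.
apply: le_trans (_ : P (N `|` \big[setU/set0]_(v : {ffun 'I_m -> 'I_b} | Vc v) C v)
   <= _)%E.
  apply: le_measure; rewrite ?inE//.
  - by rewrite -[X in measurable X]setTI; exact: measurable_funPT.
  - apply: measurableU => //; apply: bigsetU_measurable => v Vv.
    by have [] := cylV v Vv.
set U := \big[setU/set0]_(v | Vc v) C v.
have mU : measurable U.
  by apply: bigsetU_measurable => v Vv; have [] := cylV v Vv.
have h : (P (N `|` U) <= P N + P U)%E by exact: measureU2.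
apply: (le_trans h); rewrite PN0 add0e.
apply: (@le_trans _ _ (\sum_(v | Vc v) P (C v))%E).
  by apply: measure_bigsetU_le => v Vv; have [] := cylV v Vv.
rewrite (eq_bigr (fun=> (#|D|%:R ^- m)%:E)) => [|v Vv]; last by have [] := cylV v Vv.
rewrite sumEFin lee_fin sumr_const -[leLHS]mulr_natl ler_wpM2r ?invr_ge0 ?exprn_ge0//.
by rewrite ler_nat.
Qed.
End NaturalMeasure.

(** * Choice of the exponents *)

Section Exponents.

(** Bernoulli's inequality (1 + 1/c)^n >= 1 + n/c, without denominators. *)
Lemma expn_bernoulli c n : (c ^ n * (c + n) <= c.+1 ^ n * c)%N.
Proof.
elim: n => [|n IH]; first by rewrite !expn0 !mul1n addn0.
rewrite !expnS -!mulnA; apply: leq_trans (leq_mul (leqnn c.+1) IH).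
by rewrite mulnCA [(c.+1 * _)%N]mulnCA leq_mul2l; apply/orP; right; nia.
Qed.

Context {R : realType}.

Lemma half_pow c : (0 < c)%N -> (c%:R / c.+1%:R) ^+ c <= 1 / 2 :> R.
Proof.
move=> c0; have := expn_bernoulli c c.
rewrite addnn -mul2n mulnA leq_pmul2r// -(ler_nat R) natrM !natrX => h.
by rewrite expr_div_n ler_pdivrMr ?exprn_gt0 ?ltr0n//; lra.
Qed.

(** Bernoulli gives (199/200)^199 <= 1/2, and 2 * 128 >= 199. *)
Lemma tau_pow128 : ((199 / 200) ^+ 2) ^+ 128 <= 1 / 2 :> R.
Proof.
rewrite -exprM; apply: le_trans (half_pow (isT : (0 < 199)%N)).
have t0 : 0 <= 199 / 200 :> R by lra.
have t1 : 199 / 200 <= 1 :> R by lra.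
exact: (ler_wiXn2l t0 t1 (isT : (199 <= 2 * 128)%N)).
Qed.

Lemma cube_le_exp b : (4 <= b)%N -> (b * (2 * b ^ 2 + 1) + 2 <= 2 ^ (b + 5))%N.
Proof.
elim: b => // b IH; rewrite leq_eqVlt => /orP[/eqP <-//|]; rewrite ltnS => b4.
rewrite addSn [(2 ^ (b + 5).+1)%N]expnS.
apply: leq_trans (leq_mul (leqnn 2) (IH b4)).
rewrite -!mulnn; have [c ->] : exists c, b = (c + 4)%N by exists (b - 4)%N; lia.
by clear; nia.
Qed.

(** By Bernoulli, (b/(b-1))^(2 b^2) exceeds 2 (b-1). This is the decay 2^-k of the diagonal term and
    the reason for V = b^2. *)
Lemma ratio1 b : (4 <= b)%N ->
  (b%:R - 1) ^+ (2 * b ^ 2).+1 / b%:R ^+ (2 * b ^ 2) <= 1 / 2 :> R.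
Proof.
case: b => // c c3; rewrite -natr1 addrK natr1.
rewrite ler_pdivrMr ?exprn_gt0 ?ltr0n//.
set n := (2 * c.+1 ^ 2)%N.
have h : (2 * c ^ n.+1 * c <= c.+1 ^ n * c)%N.
  apply: leq_trans (expn_bernoulli c n).
  rewrite expnSr [(2 * _)%N]mulnC -!mulnA leq_mul2l /n; apply/orP; right; nia.
rewrite leq_pmul2r in h; last by lia.
by move: h; rewrite -(ler_nat R) natrM !natrX; lra.
Qed.

(** Since 2^(b+12) = 128 * 2^(b+5), [tau_pow128] bounds the first factor by 2^-(2^(b+5)), while b -
    1 <= 2^b bounds the second by 2^(b (2 b^2 + 1)); [cube_le_exp] compares the exponents. *)
Lemma ratio2 b : (4 <= b)%N ->
  ((199 / 200) ^+ 2) ^+ (2 ^ (b + 12)) * (b%:R - 1) ^+ (2 * b ^ 2).+1 <= 1 / 4 :> R.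
Proof.
move=> b4.
have -> : (2 ^ (b + 12) = 128 * 2 ^ (b + 5))%N.
  by rewrite (_ : b + 12 = 7 + (b + 5))%N ?expnD//; lia.
rewrite exprM.
have b1 : 0 <= b%:R - 1 :> R by rewrite subr_ge0 ler1n; lia.
apply: le_trans (_ : (1 / 2) ^+ (2 ^ (b + 5)) * (2 ^+ b) ^+ (2 * b ^ 2).+1 <= _).
  have t0 : 0 <= ((199 / 200) ^+ 2) ^+ 128 :> R by apply/exprn_ge0/exprn_ge0; lra.
  have h0 : 0 <= 1 / 2 :> R by lra.
  have p0 : 0 <= 2 ^+ b :> R by exact: exprn_ge0.
  apply: ler_pM; [exact: exprn_ge0 t0 | exact: exprn_ge0 b1 | |].
    exact: lerXn2r t0 h0 tau_pow128.
  apply: (lerXn2r _ b1 p0); rewrite -natrX lerBlDr natr1 ler_nat.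
  by apply: ltnW; rewrite ltnS ltnW// ltn_expl.
have -> : (2 ^+ b) ^+ (2 * b ^ 2).+1 = 2 ^+ (b * (2 * b ^ 2 + 1)) :> R.
  by rewrite -exprM addn1.
have -> : (1 / 2) ^+ (2 ^ (b + 5)) = (2 ^+ (2 ^ (b + 5)))^-1 :> R.
  by rewrite expr_div_n expr1n div1r.
rewrite mulrC ler_pdivrMr ?exprn_gt0//.
have : 2 ^+ (b * (2 * b ^ 2 + 1) + 2) <= 2 ^+ (2 ^ (b + 5)) :> R.
  by rewrite ler_eXn2l ?ltr1n// cube_le_exp.
rewrite exprD; move: (2 ^+ (b * _)) (2 ^+ (2 ^ _)) => x y; lra.
Qed.

(** Arithmetic of one block, for c = |D| and th = (199/200)^2. The digit length 2 (T+V) k exceeds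
    the ball level (2T-1) k by (2V+1) k, so both terms carry c^((2V+1) k). In the diagonal term Q/H
    is of order b^(-2 V k), and the hypothesis from [ratio1] gives 2^-k. In the other, H of order
    b^((T+2V) k) absorbs the power b^((T+V) k) coming from Lam, leaving at most (th^T c^(2V+1))^k <=
    4^-k against the divisor factor 2^k. *)
Lemma geometric_bound (b T V k : nat) (c th Cd w0 Lam Q H : R) :
  (4 <= b)%N -> c = b%:R - 1 -> 0 <= th -> th <= 1 -> 0 <= Cd -> 0 <= w0 -> 0 <= Lam ->
  Lam ^+ 2 <= th * b%:R * c ^+ 2 -> 0 < H -> (0 < T)%N ->
  Q * b%:R ^+ (2 * V * k) = H * b%:R ^+ (2 * T + 2) ->
  H * b%:R ^+ (T + 2) = b%:R ^+ ((T + 2 * V) * k) ->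
  c ^+ (2 * V).+1 / b%:R ^+ (2 * V) <= 1 / 2 ->
  th ^+ T * c ^+ (2 * V).+1 <= 1 / 4 ->
  4 / c ^+ ((2 * T - 1) * k) *
    (4 * Q * c ^+ (2 * (T + V) * k) / H
     + 8 * (Cd * 2 ^+ k) * (Lam ^+ (2 * (T + V) * k) * w0) / H)
  <= (16 * b%:R ^+ (2 * T + 2) + 32 * Cd * w0 * b%:R ^+ (T + 2)) / 2 ^+ k.
Proof.
move=> b4 cE th0 th1 Cd0 w00 L0 L2 H0 T0 QE HE r1 r2.
have b0 : 0 < b%:R :> R by rewrite ltr0n (leq_trans _ b4).
have b1 : 1 <= b%:R :> R by rewrite ler1n (leq_trans _ b4).
have c0 : 0 < c by rewrite cE subr_gt0 ltr1n (leq_trans _ b4).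
have bn i : b%:R ^+ i != 0 :> R by rewrite expf_neq0// gt_eqF.
have cn0 i : c ^+ i != 0 by rewrite expf_neq0// gt_eqF.
have Hn : H != 0 by rewrite gt_eqF.
have e1 : (2 * (T + V) * k = (2 * T - 1) * k + (2 * V).+1 * k)%N by clear -T0; nia.
have e2 : ((T + 2 * V) * k = (T + V) * k + V * k)%N by clear; nia.
have e3 : ((T + V) * k = T * k + V * k)%N by clear; nia.
have cm0 : 0 < c ^+ ((2 * T - 1) * k) by rewrite exprn_gt0.
have cn : c ^+ (2 * (T + V) * k) = c ^+ ((2 * T - 1) * k) * (c ^+ (2 * V).+1) ^+ k.
  by rewrite -exprM -exprD e1.
have QH : Q / H = b%:R ^+ (2 * T + 2) / (b%:R ^+ (2 * V)) ^+ k.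
  by rewrite -exprM; apply/eqP; rewrite eqr_div// QE mulrC.
have Hi : H^-1 = b%:R ^+ (T + 2) / b%:R ^+ ((T + 2 * V) * k).
  by rewrite -HE invfM mulrCA divff// mulr1.
rewrite [leRHS]mulrDl mulrDr; apply: lerD.
  have -> : 4 / c ^+ ((2 * T - 1) * k) * (4 * Q * c ^+ (2 * (T + V) * k) / H)
     = 16 * b%:R ^+ (2 * T + 2) * (c ^+ (2 * V).+1 / b%:R ^+ (2 * V)) ^+ k.
    transitivity (16 / c ^+ ((2 * T - 1) * k) * (Q / H) * c ^+ (2 * (T + V) * k)).
      by field; rewrite Hn cn0.
    rewrite QH cn expr_div_n; field.
    by rewrite cn0 -exprM bn.
  rewrite ler_wpM2l ?mulr_ge0 ?exprn_ge0 ?(ltW b0)//.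
  rewrite -[leRHS]exprVn lerXn2r ?nnegrE ?invr_ge0 ?divr_ge0 ?exprn_ge0 ?(ltW c0) ?(ltW b0)//.
  by rewrite -[leRHS]div1r.
have Ln : Lam ^+ (2 * (T + V) * k) <= (th * b%:R * c ^+ 2) ^+ ((T + V) * k).
  rewrite -mulnA exprM lerXn2r ?nnegrE ?sqr_ge0//.
  by rewrite !mulr_ge0 ?sqr_ge0// ltW.
have h4 : c ^- ((2 * T - 1) * k) * ((th * b%:R * c ^+ 2) ^+ ((T + V) * k)
     / b%:R ^+ ((T + 2 * V) * k)) <= (th ^+ T * c ^+ (2 * V).+1) ^+ k.
  have -> : c ^- ((2 * T - 1) * k) * ((th * b%:R * c ^+ 2) ^+ ((T + V) * k)
     / b%:R ^+ ((T + 2 * V) * k))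
     = (th ^+ T * c ^+ (2 * V).+1) ^+ k * (th ^+ V / b%:R ^+ V) ^+ k.
    have cc : (c ^+ 2) ^+ ((T + V) * k) = c ^+ ((2 * T - 1) * k) * (c ^+ (2 * V).+1) ^+ k.
      by rewrite -exprM mulnA cn.
    have -> : (th * b%:R * c ^+ 2) ^+ ((T + V) * k) = th ^+ ((T + V) * k)
        * b%:R ^+ ((T + V) * k) * (c ^+ 2) ^+ ((T + V) * k) by rewrite !exprMn.
    rewrite cc.
    have -> : b%:R ^+ ((T + 2 * V) * k) = b%:R ^+ ((T + V) * k) * (b%:R ^+ V) ^+ k :> R.
      by rewrite -exprM -exprD -e2.
    have -> : th ^+ ((T + V) * k) = (th ^+ T) ^+ k * (th ^+ V) ^+ k.
      by rewrite -!exprM -exprD e3.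
    rewrite !exprMn exprVn; field.
    by rewrite cn0 !bn -exprM bn.
  rewrite ler_piMr ?exprn_ge0 ?mulr_ge0 ?exprn_ge0 ?(ltW c0)//.
  rewrite exprn_ile1 ?divr_ge0 ?exprn_ge0 ?(ltW b0)//.
  rewrite ler_pdivrMr ?exprn_gt0// mul1r.
  have tv : th ^+ V <= 1 by exact: exprn_ile1.
  have bv : 1 <= b%:R ^+ V :> R by exact: exprn_ege1.
  exact: le_trans tv bv.
have h5 : (th ^+ T * c ^+ (2 * V).+1) ^+ k <= (1 / 4) ^+ k.
  by rewrite lerXn2r ?nnegrE ?mulr_ge0 ?exprn_ge0 ?(ltW c0)//; lra.
apply: le_trans (_ : 32 * Cd * w0 * b%:R ^+ (T + 2) * 2 ^+ k *
   (c ^- ((2 * T - 1) * k) * ((th * b%:R * c ^+ 2) ^+ ((T + V) * k)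
     / b%:R ^+ ((T + 2 * V) * k))) <= _).
  rewrite Hi.
  have -> : 4 / c ^+ ((2 * T - 1) * k) * (8 * (Cd * 2 ^+ k) *
      (Lam ^+ (2 * (T + V) * k) * w0) * (b%:R ^+ (T + 2) / b%:R ^+ ((T + 2 * V) * k)))
    = 32 * Cd * w0 * b%:R ^+ (T + 2) * 2 ^+ k *
   (c ^- ((2 * T - 1) * k) * (Lam ^+ (2 * (T + V) * k)
     / b%:R ^+ ((T + 2 * V) * k))).
    by field; rewrite cn0 bn.
  rewrite ler_wpM2l ?mulr_ge0 ?exprn_ge0 ?(ltW b0)//.
  rewrite ler_wpM2l ?invr_ge0 ?(ltW cm0)// ler_wpM2r ?invr_ge0 ?exprn_ge0 ?(ltW b0)//.
have C0 : 0 <= 32 * Cd * w0 * b%:R ^+ (T + 2) * 2 ^+ k.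
  by rewrite !mulr_ge0// exprn_ge0// ltW.
apply: (le_trans (ler_wpM2l C0 (le_trans h4 h5))).
have p2 : 2 ^+ k != 0 :> R by rewrite expf_neq0.
have q4 : (1 / 4) ^+ k = (2 ^+ k * 2 ^+ k)^-1 :> R.
  by rewrite -exprMn expr_div_n expr1n div1r; congr ((_ ^+ _)^-1); ring.
by rewrite q4 le_eqVlt; apply/orP; left; apply/eqP; field.
Qed.
End Exponents.

(** * Well-approximable points as a limsup of blocks *)

Section LimSup.
Context {R : realType}.
Variables (K : set R) (al : R).

Definition approx_at (q : nat) : set R :=
  [set x | (0 < q)%N /\
     exists2 p : nat, K (p%:R / q%:R) & `|x - p%:R / q%:R| < q%:R `^ (- al)].

(** As K lies in [0, 1], a denominator q admits only the numerators 0, ..., q; infinitely many pairs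
    therefore means arbitrarily large q. *)
Lemma well_approximable_lim_sup : (forall y, K y -> 0 <= y <= 1) ->
  well_approximable K al = lim_sup_set approx_at.
Proof.
move=> K01; apply/seteqP; split => x.
- move=> xinf n _; apply: contrapT => hn; apply: xinf.
  apply: (@sub_finite_set _ _
    ((fun k : nat * nat => (Posz k.1, k.2)) @` (`I_n `*` `I_n))); last first.
    by apply: finite_image; apply: finite_setX; exact: finite_II.
  move=> [p q] [/= q0 Kpq hx].
  have [k pE] : exists k : nat, p = k.
    case: p Kpq {hx} => [k|k] Kpq; first by exists k.
    have /K01/andP[+ _] := Kpq.
    by rewrite pmulr_lge0 ?invr_gt0 ?ltr0n// ler0z.
  rewrite pE -pmulrn in Kpq hx *.
  have qn : (q < n)%N.
    by rewrite ltnNge; apply/negP => nq; apply: hn; exists q => //; split => //; exists k.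
  have kq : (k <= q)%N.
    by have /K01/andP[_] := Kpq; rewrite ler_pdivrMr ?ltr0n// mul1r ler_nat.
  by exists (k, q) => //; split => //=; exact: leq_ltn_trans kq qn.
- move=> xl /finite_seqP[s sE].
  have [q /= nq [q0 [p Kp hx]]] := xl (\max_(z <- s) z.2).+1 I.
  have zs : [set` s] (Posz p, q) by rewrite -sE; split => //=; rewrite -pmulrn.
  by move: nq; rewrite (big_rem _ zs)/= ltnNge leq_maxl.
Qed.

Lemma measurable_approx_at q : measurable (approx_at q).
Proof.
have [->|q0] := posnP q.
  by rewrite (_ : approx_at 0 = set0)//; apply/seteqP; split => x // -[].
rewrite (_ : approx_at q = \bigcup_(p in [set p : nat | K (p%:R / q%:R)])
   ball (p%:R / q%:R : R) (q%:R `^ (- al))).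
  by apply: bigcup_measurable => p _; exact: measurable_realfun.measurable_ball.
apply/seteqP; split => x.
- by move=> [_ [p Kp hx]]; exists p => //; rewrite /ball/= distrC.
- by move=> [p Kp hx]; split => //; exists p => //; move: hx; rewrite /ball/= distrC.
Qed.

(** Within a block q varies by a bounded factor b^T, so a single digit length n serves all its
    denominators. *)
Definition approx_block (b T j : nat) : set R :=
  \big[setU/set0]_(1 <= q < b ^ (T * j.+1) | (b ^ (T * j) <= q)%N) approx_at q.

Lemma lim_sup_block (b T : nat) : (1 < b)%N -> (0 < T)%N ->
  lim_sup_set approx_at `<=` lim_sup_set (fun j => approx_block b T j.+1).
Proof.
move=> b1 T0 x xl n _; have [q /= nq xq] := xl (b ^ (T * n.+1))%N I.
have b0 : (0 < b)%N by exact: ltnW.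
have q0 : (0 < q)%N by have [] := xq.
have /andP[l1 l2] := trunc_log_bounds b1 q0; set l := trunc_log b q in l1 l2.
have Tl : (T * n.+1 <= l)%N.
  rewrite leqNgt; apply/negP => h; have : (q < b ^ (T * n.+1))%N.
    by apply: leq_trans l2 _; rewrite leq_pexp2l.
  by rewrite ltnNge nq.
(* The block containing q. The shift to j + 1 keeps block numbers positive, as [block_measure]
   requires. *)
pose k := (l %/ T)%N.
have kn : (n < k)%N by rewrite leq_divRL// mulnC.
have kE : k.-1.+1 = k by rewrite prednK// (leq_ltn_trans _ kn).
exists k.-1 => /=; first by rewrite -ltnS kE.
rewrite /approx_block -bigcup_seq_cond kE; exists q => //=.
rewrite mem_index_iota q0/=; apply/andP; split.
- by apply: leq_trans l2 _; rewrite leq_pexp2l// mulnC ltn_ceil.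
- by apply: leq_trans l1; rewrite leq_pexp2l// mulnC leq_trunc_div.
Qed.
End LimSup.

(** An interval of length q < M holds at most one multiple of M, so a digit string and q determine
    the numerator p. *)
Lemma multiple_unique (a q M p p' : nat) : (q < M)%N ->
  (a <= p * M <= q + a)%N -> (a <= p' * M <= q + a)%N -> p = p'.
Proof.
move=> qM /andP[p1 p2] /andP[p3 p4]; case: (ltngtP p p') => // h;
  have := leq_mul h (leqnn M); rewrite mulSn; lia.
Qed.

(** * Measure of one block and Borel-Cantelli *)

Section BlockMeasure.
Context {R : realType} (b T : nat) (D : {set 'I_b}) (nu : probability R R).
Hypotheses (aD : admissible D) (nuD : natural_measure D nu) (T0 : (0 < T)%N).
Hypothesis rT :
  ((199 / 200) ^+ 2) ^+ T * (b%:R - 1) ^+ (2 * b ^ 2).+1 <= 1 / 4 :> R.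
Let al : R := 2 - T%:R^-1.
Let K := missing_digit_set R D.
Let b4 : (4 <= b)%N := admissible_base aD.

(** Since al T = 2 T - 1, the radius at q = b^(T k) is an integral power of b; this motivates the
    form rho = 1/T. *)
Lemma radius_le k q : (b ^ (T * k) <= q)%N ->
  q%:R `^ (- al) <= b%:R ^- ((2 * T - 1) * k) :> R.
Proof.
move=> hq; have b0 : (0 < b)%N by exact: leq_trans b4.
have q0 : (0 < q)%N by apply: leq_trans hq; rewrite expn_gt0 b0.
have TR : T%:R != 0 :> R by rewrite pnatr_eq0 -lt0n.
have al0 : 0 <= al.
  rewrite subr_ge0 invf_ple ?posrE ?ltr0n//; apply: le_trans (_ : 1 <= _).
    by rewrite invf_le1// ler1n.
  by rewrite ler1n.
rewrite powRN lef_pV2 ?posrE ?powR_gt0 ?exprn_gt0 ?ltr0n//.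
have -> : b%:R ^+ ((2 * T - 1) * k) = (b ^ (T * k))%:R `^ al :> R.
  rewrite natrX -[b%:R ^+ (T * k)]powR_mulrn// -powRrM -[LHS]powR_mulrn//.
  congr (_ `^ _).
  rewrite !natrM natrB ?muln_gt0// natrM /al; field.
  exact: TR.
by apply: ge0_ler_powR; rewrite ?nnegrE// ler_nat.
Qed.

Lemma block_measure : exists2 C : R, 0 <= C & forall k, (0 < k)%N ->
  (nu (approx_block K al b T k) <= (C / 2 ^+ k)%:E)%E.
Proof.
have b0 : (0 < b)%N by exact: leq_trans b4.
have b1 : (1 < b)%N by exact: leq_trans b4.
have cD := admissible_card aD.
have D0 : (0 < #|D|)%N by rewrite cD -ltnS prednK.
have cR : #|D|%:R = b%:R - 1 :> R by rewrite cD -subn1 natrB.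
have [w [Lam [L0 L2 w1 hw]]] := transfer_exists R aD.
(* The value of r gives b^n <= 2^(b n) = (2^k)^r, so the divisor bound costs only a factor 2^k per
   block. *)
pose V := (b ^ 2)%N; pose r := (2 * b * (T + V))%N.
have r0 : (0 < r)%N by rewrite /r !muln_gt0 b0 addn_gt0 T0.
have [Cd Cd0 hCd] := ndiv_bound r0.
have w00 : 0 <= w 0 by apply: le_trans (w1 0 _); rewrite ?lexx/=.
exists (16 * b%:R ^+ (2 * T + 2) + 32 * Cd%:R * w 0 * b%:R ^+ (T + 2)).
  by rewrite addr_ge0// !mulr_ge0// exprn_ge0.
move=> k k0.
pose n := (2 * (T + V) * k)%N; pose m := ((2 * T - 1) * k)%N.
(* H is b^n / (Q b^2); the factor b^2 >= 16 pays for the 16 in [count_bound]. *)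
pose Q := (b ^ (T * k.+1))%N; pose H := (b ^ ((T + 2 * V) * k - (T + 2)))%N.
have V1 : (1 <= V)%N by rewrite expn_gt0 b0.
have HE : (H * b ^ (T + 2) = b ^ ((T + 2 * V) * k))%N.
  by rewrite -expnD subnK//; nia.
have QM : (H * Q * b ^ 2 = b ^ n)%N.
  have -> : (H * Q * b ^ 2 = (H * b ^ (T + 2)) * b ^ (T * k))%N.
    have Q2 : (Q * b ^ 2 = b ^ (T + 2) * b ^ (T * k))%N.
      by rewrite /Q -!expnD; congr (b ^ _)%N; lia.
    by rewrite -mulnA Q2 mulnA.
  by rewrite HE -expnD; congr (b ^ _)%N; rewrite /n; lia.
have H0 : (0 < H)%N by rewrite expn_gt0 b0.
have HM : (16 * H * Q <= b ^ n)%N.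
  by rewrite -QM -mulnA mulnC leq_mul2l (@leq_exp2r 4 b 2) ?b4 ?orbT.
have QltM : (Q <= b ^ n)%N by apply: leq_trans HM; rewrite leq_pmull// muln_gt0.
have QE : (Q * b ^ (2 * V * k) = H * b ^ (2 * T + 2))%N.
  have -> : (H * b ^ (2 * T + 2) = (H * b ^ (T + 2)) * b ^ T)%N.
    have T2 : (b ^ (2 * T + 2) = b ^ (T + 2) * b ^ T)%N.
      by rewrite -expnD; congr (b ^ _)%N; lia.
    by rewrite T2 mulnA.
  by rewrite HE /Q -!expnD; congr (b ^ _)%N; lia.
have hDm k' : (0 < k' < b ^ n)%N -> (ndiv k')%:R <= Cd%:R * 2 ^+ k :> R.
  move=> /andP[k'0 k'M]; rewrite -natrX -natrM ler_nat.
  rewrite -(@leq_exp2r _ _ r)//; apply: leq_trans (hCd _ k'0) _.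
  rewrite expnMn leq_mul//; first by rewrite -{1}[Cd]expn1 leq_pexp2l.
  apply: leq_trans (ltnW k'M) _; apply: leq_trans (_ : (2 ^ b) ^ n <= _)%N.
    have n0 : (0 < n)%N by rewrite /n !muln_gt0 k0 addn_gt0 T0.
    by rewrite leq_exp2r// ltnW// ltn_expl.
  by rewrite -!expnM leq_exp2l// /n /r; nia.
pose hit (v : {ffun 'I_n -> 'I_b}) (q p : nat) : Prop :=
  (digits_val v * q <= p * b ^ n <= (digits_val v).+1 * q)%N.
pose A v q := (b ^ (T * k) <= q)%N && `[< exists p, hit v q p >].
(* The numerator attached to (v, q), or 0 if there is none; [multiple_unique] identifies it with the
   actual p. *)
pose pc v q := xget 0%N [set p | hit v q p].
have cnt : \sum_(1 <= q < Q) \sum_(v : {ffun 'I_n -> 'I_b} | v \in ffun_on (mem D))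
    (A v q)%:R <= 4 * Q%:R * #|D|%:R ^+ n / H%:R
      + 8 * (Cd%:R * 2 ^+ k) * (Lam ^+ n * w 0) / H%:R :> R.
  have Dm0 : 0 <= Cd%:R * 2 ^+ k :> R by rewrite mulr_ge0// exprn_ge0.
  have hS : \sum_(k' < b ^ n) phi_prod n D k' <= Lam ^+ n * w 0.
    exact: (phi_l1_bound b0 L0 hw n w1).
  by apply: (count_bound b0 H0 HM hDm Dm0 hS) => v q _ /andP[_ /asboolP].
pose Ball v q := [set x : R | `|x - (pc v q)%:R / q%:R| < b%:R ^- m].
have mBall v q : measurable (Ball v q).
  rewrite (_ : Ball v q = ball ((pc v q)%:R / q%:R : R) (b%:R ^- m)); last first.
    by apply/seteqP; split => x; rewrite /Ball /ball/= distrC.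
  exact: measurable_realfun.measurable_ball.
pose U q := \big[setU/set0]_(v : {ffun 'I_n -> 'I_b} | (v \in ffun_on (mem D)) && A v q)
   Ball v q.
have mU q : measurable (U q) by apply: bigsetU_measurable.
have sub q : (1 <= q < Q)%N -> (b ^ (T * k) <= q)%N -> approx_at K al q `<=` U q.
  move=> /andP[q0 qQ] hq x [_ [p [p01 [d [dD dcv]]] hx]].
  have qR : 0 < q%:R :> R by rewrite ltr0n.
  have bnR : 0 < b%:R ^+ n :> R by rewrite exprn_gt0// ltr0n.
  pose v := [ffun i : 'I_n => d i].
  have /andP[v1 v2] := digit_series_bounds n b1 dcv; rewrite -/v in v1 v2.
  have hv : hit v q p.
    apply/andP; split; rewrite -(ler_nat R) !natrM natrX.
      by move: v1; rewrite ler_pdivrMr// mulrAC ler_pdivlMr.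
    move: v2; rewrite -{2}[_ ^- n]mul1r -mulrDl natr1 ler_pdivrMr// mulrAC.
    by rewrite ler_pdivlMr.
  have pcE : pc v q = p.
    have hp : hit v q (pc v q) by apply: (@xgetPex _ 0%N [set p | hit v q p]); exists p.
    have qM : (q < b ^ n)%N by exact: leq_trans qQ QltM.
    by move: hv hp; rewrite /hit mulSn => hv hp; exact: (multiple_unique qM hp hv).
  rewrite /U -bigcup_seq_cond; exists v.
    rewrite /= mem_index_enum/=; apply/andP; split.
      by apply/ffun_onP => i; rewrite ffunE; exact: dD.
    by rewrite /A hq/=; apply/asboolP; exists p.
  by rewrite /Ball /= pcE; apply: lt_le_trans hx (radius_le hq).
pose F q := if (b ^ (T * k) <= q)%N then U q else set0.
have mF q : measurable (F q) by rewrite /F; case: ifP.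
have mB : measurable (approx_block K al b T k).
  by apply: bigsetU_measurable => q _; exact: measurable_approx_at.
have subF : approx_block K al b T k `<=` \big[setU/set0]_(1 <= q < Q) F q.
  rewrite /approx_block -bigcup_seq_cond -bigcup_seq => x [q /= /andP[]].
  rewrite mem_index_iota => qQ hq xq; exists q; rewrite /= ?mem_index_iota//.
  by rewrite /F hq; exact: sub.
have mUF : measurable (\big[setU/set0]_(1 <= q < Q) F q) by apply: bigsetU_measurable.
apply: (@le_trans _ _ (nu (\big[setU/set0]_(1 <= q < Q) F q))).
  by apply: le_measure; rewrite ?inE.
apply: (@le_trans _ _ (\sum_(1 <= q < Q) nu (F q))%E).
  by apply: measure_bigsetU_le.
have nuF q : (nu (F q) <= (4 / #|D|%:R ^+ m *
   \sum_(v : {ffun 'I_n -> 'I_b} | v \in ffun_on (mem D)) (A v q)%:R)%:E)%E.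
  rewrite /F; case: ifP => hq; last first.
    by rewrite measure0 lee_fin mulr_ge0 ?divr_ge0 ?exprn_ge0// sumr_ge0.
  apply: (@le_trans _ _ (\sum_(v : {ffun 'I_n -> 'I_b} |
     (v \in ffun_on (mem D)) && A v q) nu (Ball v q))%E).
    by apply: measure_bigsetU_le.
  rewrite mulr_sumr -sumEFin big_mkcondr/=; apply: lee_sum => v vD.
  by case: (A v q); rewrite ?mulr1 ?mulr0//; exact: ball_measure.
apply: (@le_trans _ _ (\sum_(1 <= q < Q) (4 / #|D|%:R ^+ m *
   \sum_(v : {ffun 'I_n -> 'I_b} | v \in ffun_on (mem D)) (A v q)%:R)%:E)%E).
  by apply: lee_sum => q _; exact: nuF.
rewrite sumEFin lee_fin -mulr_sumr.
apply: le_trans (ler_wpM2l _ cnt) _; first by rewrite divr_ge0// exprn_ge0.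
rewrite cR /n /m.
have t0 : 0 <= (199 / 200) ^+ 2 :> R by rewrite exprn_ge0//; lra.
have t1 : (199 / 200) ^+ 2 <= 1 :> R by lra.
have HR : 0 < H%:R :> R by rewrite ltr0n.
apply: (@geometric_bound R b T V k (b%:R - 1) ((199 / 200) ^+ 2)) => //.
- by rewrite -!natrX -!natrM QE.
- by rewrite -!natrX -!natrM HE.
- exact: ratio1.
Qed.

Lemma well_approximable_null :
  nu (well_approximable K al) = 0%E.
Proof.
have [C C0 hC] := block_measure.
have b1 : (1 < b)%N by exact: leq_trans b4.
have K01 y : K y -> 0 <= y <= 1 by move=> [].
rewrite well_approximable_lim_sup//.
have mA := measurable_approx_at K al.
have mB j : measurable (approx_block K al b T j.+1).
  by apply: bigsetU_measurable => q _; exact: mA.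
have msup (F : (set R)^nat) : (forall j, measurable (F j)) ->
    measurable (lim_sup_set F).
  by move=> mF; apply: bigcap_measurable => // i _; exact: bigcup_measurable.
apply/eqP; rewrite eq_le measure_ge0 andbT.
have <- : nu (lim_sup_set (fun j => approx_block K al b T j.+1)) = 0%E.
  apply: lim_sup_set_cvg0 => //.
  apply: (@le_lt_trans _ _ (\sum_(0 <= j <oo) (C / (2 ^ j.+1)%:R)%:E)%E).
    by apply: lee_nneseries => // j _; rewrite natrX; exact: hC.
  by apply: le_lt_trans (epsilon_trick0 xpredT C0) _; rewrite ltry.
apply: le_measure; rewrite ?inE; [exact: msup | exact: msup |].
exact: lim_sup_block.
Qed.
End BlockMeasure.

Theorem theorem1p4 (R : realType) :
  exists rho : forall b : nat, {set 'I_b} -> R,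
    effectively_computable admissible rho /\
    forall (b : nat) (D : {set 'I_b}), admissible D ->
      0 < rho b D /\
      forall nu : probability R R, natural_measure D nu ->
        nu (well_approximable (missing_digit_set R D) (2 - rho b D)) = 0%E.
Proof.
(* This is 1/T for T = 2^(b+12), the exponent handled by [ratio2]. *)
exists (fun b _ => 2 ^- (b + 12)); split; first exact: rho_computable.
move=> b D aD; split; first by rewrite invr_gt0 exprn_gt0.
move=> nu nuD; rewrite -natrX.
apply: well_approximable_null => //; first by rewrite expn_gt0.
exact: ratio2 (admissible_base aD).
Qed.
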